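(* Let $N$ be a nonlinear connection on $E^*=J^{1*}(\mathcal T,M)$ and $D$ an $N$-linear connection with adapted coefficients $D\Gamma(N)$. The $18$ local curvature d-tensors of $D$ are given by: 1. $R^d_{abc}=\dfrac{\delta A^d_{ab}}{\delta t^c}-\dfrac{\delta A^d_{ac}}{\delta t^b}+A^f_{ab}A^d_{fc}-A^f_{ac}A^d_{fb}+C^{d(r)}_{a(f)}R^{(f)}_{(r)bc}$, 2. $R^d_{abk}=\dfrac{\delta A^d_{ab}}{\delta x^k}-\dfrac{\delta H^d_{ak}}{\delta t^b}+A^f_{ab}H^d_{fk}-H^f_{ak}A^d_{fb}+C^{d(r)}_{a(f)}R^{(f)}_{(r)bk}$, 3. $P^{d\ (k)}_{ab(c)}=\dfrac{\partial A^d_{ab}}{\partial p^c_k}-C^{d(k)}_{a(c)/b}+C^{d(r)}_{a(f)}P^{(f)\ (k)}_{(r)b(c)}$, 4. $R^d_{ajk}=\dfrac{\delta H^d_{aj}}{\delta x^k}-\dfrac{\delta H^d_{ak}}{\delta x^j}+H^f_{aj}H^d_{fk}-H^f_{ak}H^d_{fj}+C^{d(r)}_{a(f)}R^{(f)}_{(r)jk}$, 5. $P^{d\ (k)}_{aj(c)}=\dfrac{\partial H^d_{aj}}{\partial p^c_k}-C^{d(k)}_{a(c)|j}+C^{d(r)}_{a(f)}P^{(f)\ (k)}_{(r)j(c)}$, 6. $S^{d(j)(k)}_{a(b)(c)}=\dfrac{\partial C^{d(j)}_{a(b)}}{\partial p^c_k}-\dfrac{\partial C^{d(k)}_{a(c)}}{\partial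 p^b_j}+C^{f(j)}_{a(b)}C^{d(k)}_{f(c)}-C^{f(k)}_{a(c)}C^{d(j)}_{f(b)}$, 7. $R^l_{ibc}=\dfrac{\delta A^l_{ib}}{\delta t^c}-\dfrac{\delta A^l_{ic}}{\delta t^b}+A^r_{ib}A^l_{rc}-A^r_{ic}A^l_{rb}+C^{l(r)}_{i(f)}R^{(f)}_{(r)bc}$, 8. $R^l_{ibk}=\dfrac{\delta A^l_{ib}}{\delta x^k}-\dfrac{\delta H^l_{ik}}{\delta t^b}+A^r_{ib}H^l_{rk}-H^r_{ik}A^l_{rb}+C^{l(r)}_{i(f)}R^{(f)}_{(r)bk}$, 9. $P^{l\ (k)}_{ib(c)}=\dfrac{\partial A^l_{ib}}{\partial p^c_k}-C^{l(k)}_{i(c)/b}+C^{l(r)}_{i(f)}P^{(f)\ (k)}_{(r)b(c)}$, 10. $R^l_{ijk}=\dfrac{\delta H^l_{ij}}{\delta x^k}-\dfrac{\delta H^l_{ik}}{\delta x^j}+H^r_{ij}H^l_{rk}-H^r_{ik}H^l_{rj}+C^{l(r)}_{i(f)}R^{(f)}_{(r)jk}$, 11. $P^{l\ (k)}_{ij(c)}=\dfrac{\partial H^l_{ij}}{\partial p^c_k}-C^{l(k)}_{i(c)|j}+C^{l(r)}_{i(f)}P^{(f)\ (k)}_{(r)j(c)}$, 12. $S^{l(j)(k)}_{i(b)(c)}=\dfrac{\partial C^{l(j)}_{i(b)}}{\partial p^c_k}-\dfrac{\partial C^{l(k)}_{i(c)}}{\partial p^b_j}+C^{r(j)}_{i(b)}C^{l(k)}_{r(c)}-C^{r(k)}_{i(c)}C^{l(j)}_{r(b)}$,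 13. $R^{(d)(i)}_{(l)(a)bc}=\dfrac{\delta A^{(d)(i)}_{(l)(a)b}}{\delta t^c}-\dfrac{\delta A^{(d)(i)}_{(l)(a)c}}{\delta t^b}+A^{(d)(r)}_{(l)(f)b}A^{(f)(i)}_{(r)(a)c}-A^{(d)(r)}_{(l)(f)c}A^{(f)(i)}_{(r)(a)b}+C^{(d)(i)(r)}_{(l)(a)(f)}R^{(f)}_{(r)bc}$, 14. $R^{(d)(i)}_{(l)(a)bk}=\dfrac{\delta A^{(d)(i)}_{(l)(a)b}}{\delta x^k}-\dfrac{\delta H^{(d)(i)}_{(l)(a)k}}{\delta t^b}+A^{(d)(r)}_{(l)(f)b}H^{(f)(i)}_{(r)(a)k}-H^{(d)(r)}_{(l)(f)k}A^{(f)(i)}_{(r)(a)b}+C^{(d)(i)(r)}_{(l)(a)(f)}R^{(f)}_{(r)bk}$, 15. $P^{(d)(i)\ (k)}_{(l)(a)b(c)}=\dfrac{\partial A^{(d)(i)}_{(l)(a)b}}{\partial p^c_k}-C^{(d)(i)(k)}_{(l)(a)(c)/b}+C^{(d)(i)(r)}_{(l)(a)(f)}P^{(f)\ (k)}_{(r)b(c)}$, 16. $R^{(d)(i)}_{(l)(a)jk}=\dfrac{\delta H^{(d)(i)}_{(l)(a)j}}{\delta x^k}-\dfrac{\delta H^{(d)(i)}_{(l)(a)k}}{\delta x^j}+H^{(d)(r)}_{(l)(f)j}H^{(f)(i)}_{(r)(a)k}-H^{(d)(r)}_{(l)(f)k}H^{(f)(i)}_{(r)(a)j}+C^{(d)(i)(r)}_{(l)(a)(f)}R^{(f)}_{(r)jk}$,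 17. $P^{(d)(i)\ (k)}_{(l)(a)j(c)}=\dfrac{\partial H^{(d)(i)}_{(l)(a)j}}{\partial p^c_k}-C^{(d)(i)(k)}_{(l)(a)(c)|j}+C^{(d)(i)(r)}_{(l)(a)(f)}P^{(f)\ (k)}_{(r)j(c)}$, 18. $S^{(d)(i)(j)(k)}_{(l)(a)(b)(c)}=\dfrac{\partial C^{(d)(i)(j)}_{(l)(a)(b)}}{\partial p^c_k}-\dfrac{\partial C^{(d)(i)(k)}_{(l)(a)(c)}}{\partial p^b_j}+C^{(d)(r)(j)}_{(l)(f)(b)}C^{(f)(i)(k)}_{(r)(a)(c)}-C^{(d)(r)(k)}_{(l)(f)(c)}C^{(f)(i)(j)}_{(r)(a)(b)}$.
   Context: All objects are smooth. $\mathcal T,M$ are manifolds of dimensions $m,n$ with local coordinates $(t^a)$, $(x^i)$. Indices $a,\dots,h$ run over $\{1,\dots,m\}$, indices $i,j,k,l,p,q,r,s$ over $\{1,\dots,n\}$; Einstein summation is used. $E^*=J^{1*}(\mathcal T,M)$ is the dual of the $1$-jet bundle: a vector bundle $\pi^*:E^*\to\mathcal T\times M$ with fibre $\mathbb R^{mn}$ and induced coordinates $(t^a,x^i,p^a_i)$ changing by $\tilde t^a=\tilde t^a(t)$, $\tilde x^i=\tilde x^i(x)$, $\tilde p^a_i=\frac{\partial x^j}{\partial\tilde x^i}\frac{\partial\tilde t^a}{\partial t^b}p^b_j$. A nonlinear connection $N$ is a distribution on $E^*$ complementary to the vertical distribution $\mathcal W=\ker\pi^*{}_*$; locally it is spanned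 by $\frac{\delta}{\delta t^a}=\frac{\partial}{\partial t^a}-\underset{1}{N}{}^{(b)}_{(j)a}\frac{\partial}{\partial p^b_j}$ and $\frac{\delta}{\delta x^i}=\frac{\partial}{\partial x^i}-\underset{2}{N}{}^{(b)}_{(j)i}\frac{\partial}{\partial p^b_j}$, which together with $\frac{\partial}{\partial p^a_i}$ form the adapted basis. $\mathcal H_{\mathcal T},\mathcal H_M$ are the distributions spanned by $\delta/\delta t^a$ and $\delta/\delta x^i$. Set $$R^{(a)}_{(i)bc}=\frac{\delta\underset{1}{N}{}^{(a)}_{(i)b}}{\delta t^c}-\frac{\delta\underset{1}{N}{}^{(a)}_{(i)c}}{\delta t^b},\quad R^{(a)}_{(i)bk}=\frac{\delta\underset{1}{N}{}^{(a)}_{(i)b}}{\delta x^k}-\frac{\delta\underset{2}{N}{}^{(a)}_{(i)k}}{\delta t^b},\quad R^{(a)}_{(i)jk}=\frac{\delta\underset{2}{N}{}^{(a)}_{(i)j}}{\delta x^k}-\frac{\delta\underset{2}{N}{}^{(a)}_{(i)k}}{\delta x^j}.$$ An $N$-linear connection $D$ is a linear connection on $E^*$ preserving by parallelism $\mathcal H_{\mathcal T},\mathcal H_M,\mathcal W$ (i.e. $D_X$ maps sections of each to sections of the same). Its adapted coefficients $D\Gamma(N)$ are defined by $$D_{\frac{\delta}{\delta t^c}}\tfrac{\delta}{\delta t^b}=A^a_{bc}\tfrac{\delta}{\delta t^a},\ D_{\frac{\delta}{\delta t^c}}\tfrac{\delta}{\delta x^j}=A^i_{jc}\tfrac{\delta}{\delta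 x^i},\ D_{\frac{\delta}{\delta t^c}}\tfrac{\partial}{\partial p^b_j}=-A^{(a)(j)}_{(i)(b)c}\tfrac{\partial}{\partial p^a_i},$$ $$D_{\frac{\delta}{\delta x^k}}\tfrac{\delta}{\delta t^b}=H^a_{bk}\tfrac{\delta}{\delta t^a},\ D_{\frac{\delta}{\delta x^k}}\tfrac{\delta}{\delta x^j}=H^i_{jk}\tfrac{\delta}{\delta x^i},\ D_{\frac{\delta}{\delta x^k}}\tfrac{\partial}{\partial p^b_j}=-H^{(a)(j)}_{(i)(b)k}\tfrac{\partial}{\partial p^a_i},$$ $$D_{\frac{\partial}{\partial p^c_k}}\tfrac{\delta}{\delta t^b}=C^{a(k)}_{b(c)}\tfrac{\delta}{\delta t^a},\ D_{\frac{\partial}{\partial p^c_k}}\tfrac{\delta}{\delta x^j}=C^{i(k)}_{j(c)}\tfrac{\delta}{\delta x^i},\ D_{\frac{\partial}{\partial p^c_k}}\tfrac{\partial}{\partial p^b_j}=-C^{(a)(j)(k)}_{(i)(b)(c)}\tfrac{\partial}{\partial p^a_i}.$$ The torsion components used are $$P^{(f)\ (j)}_{(r)a(b)}=\frac{\partial\underset{1}{N}{}^{(f)}_{(r)a}}{\partial p^b_j}+A^{(f)(j)}_{(r)(b)a},\qquad P^{(f)\ (j)}_{(r)i(b)}=\frac{\partial\underset{2}{N}{}^{(f)}_{(r)i}}{\partial p^b_j}+H^{(f)(j)}_{(r)(b)i}.$$ The curvature is $\mathbb R(X,Y)Z=D_XD_YZ-D_YD_XZ-D_{[X,Y]}Z$,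 and its d-tensors are defined as follows. For each of the pairs $(U,V)=\left(\tfrac{\delta}{\delta t^c},\tfrac{\delta}{\delta t^b}\right)$, $\left(\tfrac{\delta}{\delta x^k},\tfrac{\delta}{\delta t^b}\right)$, $\left(\tfrac{\partial}{\partial p^c_k},\tfrac{\delta}{\delta t^b}\right)$, $\left(\tfrac{\delta}{\delta x^k},\tfrac{\delta}{\delta x^j}\right)$, $\left(\tfrac{\partial}{\partial p^c_k},\tfrac{\delta}{\delta x^j}\right)$, $\left(\tfrac{\partial}{\partial p^c_k},\tfrac{\partial}{\partial p^b_j}\right)$, respectively: $\mathbb R(U,V)\tfrac{\delta}{\delta t^a}=K\,\tfrac{\delta}{\delta t^d}$ with $K=R^d_{abc},\,R^d_{abk},\,P^{d\ (k)}_{ab(c)},\,R^d_{ajk},\,P^{d\ (k)}_{aj(c)},\,S^{d(j)(k)}_{a(b)(c)}$; $\mathbb R(U,V)\tfrac{\delta}{\delta x^i}=K\,\tfrac{\delta}{\delta x^l}$ with $K=R^l_{ibc},\,R^l_{ibk},\,P^{l\ (k)}_{ib(c)},\,R^l_{ijk},\,P^{l\ (k)}_{ij(c)},\,S^{l(j)(k)}_{i(b)(c)}$; $\mathbb R(U,V)\tfrac{\partial}{\partial p^a_i}=-K\,\tfrac{\partial}{\partial p^d_l}$ with $K=R^{(d)(i)}_{(l)(a)bc},\,R^{(d)(i)}_{(l)(a)bk},\,P^{(d)(i)\ (k)}_{(l)(a)b(c)},\,R^{(d)(i)}_{(l)(a)jk},\,P^{(d)(i)\ (k)}_{(l)(a)j(c)},\,S^{(d)(i)(j)(k)}_{(l)(a)(b)(c)}$.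 The $\mathcal T$-horizontal covariant derivative of d-tensor components is $$T^{ai(k)(d)\dots}_{cj(b)(l)\dots/g}=\frac{\delta T^{ai(k)(d)\dots}_{cj(b)(l)\dots}}{\delta t^g}+T^{fi(k)(d)\dots}_{cj(b)(l)\dots}A^a_{fg}+T^{ar(k)(d)\dots}_{cj(b)(l)\dots}A^i_{rg}+T^{ai(r)(d)\dots}_{cj(f)(l)\dots}A^{(f)(k)}_{(r)(b)g}+\dots-T^{ai(k)(d)\dots}_{fj(b)(l)\dots}A^f_{cg}-T^{ai(k)(d)\dots}_{cr(b)(l)\dots}A^r_{jg}-T^{ai(k)(f)\dots}_{cj(b)(r)\dots}A^{(d)(r)}_{(l)(f)g}-\dots,$$ and the $M$-horizontal one, $T^{\dots}_{\dots|s}$, is given by the same formula with $\delta/\delta t^g$ replaced by $\delta/\delta x^s$ and the coefficients $A^a_{fg},A^i_{rg},A^{(f)(k)}_{(r)(b)g}$, etc. replaced by $H^a_{fs},H^i_{rs},H^{(f)(k)}_{(r)(b)s}$, etc. For example, $$C^{d(k)}_{a(c)/b}=\frac{\delta C^{d(k)}_{a(c)}}{\delta t^b}+C^{f(k)}_{a(c)}A^d_{fb}-C^{d(k)}_{f(c)}A^f_{ab}+C^{d(r)}_{a(f)}A^{(f)(k)}_{(r)(c)b},$$ $$C^{(d)(i)(k)}_{(l)(a)(c)/b}=\frac{\delta C^{(d)(i)(k)}_{(l)(a)(c)}}{\delta t^b}-C^{(f)(i)(k)}_{(r)(a)(c)}A^{(d)(r)}_{(l)(f)b}+C^{(d)(r)(k)}_{(l)(f)(c)}A^{(f)(i)}_{(r)(a)b}+C^{(d)(i)(r)}_{(l)(a)(f)}A^{(f)(k)}_{(r)(c)b}.$$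 *)

(* Defs.v *)
From HB Require Import structures.
From mathcomp Require Import all_boot all_order all_algebra.
From mathcomp Require Import all_classical all_reals all_analysis.

Set Implicit Arguments.
Unset Strict Implicit.
Unset Printing Implicit Defensive.

Import Order.TTheory GRing.Theory Num.Theory numFieldNormedType.Exports.
Local Open Scope classical_set_scope.
Local Open Scope ring_scope.

(** * Smooth maps between normed spaces *)

(** [Ck k U f]: [f] is of class C^k on [U].  It is used for finite-dimensional
    [V] and open [U], where C^(k+1) means differentiable with all directional
    derivatives of class C^k. *)
Fixpoint Ck (R : realType) (V W : normedModType R) (k : nat) (U : set V)
    (f : V -> W) : Prop :=
  if k is k'.+1 then
    (forall x, U x -> differentiable f x) /\
    (forall v : V, Ck k' U (fun x => 'D_v f x))
  else forall x, U x -> {for x, continuous f}.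

Definition Cinf (R : realType) (V W : normedModType R) (U : set V)
    (f : V -> W) : Prop := forall k, Ck k U f.

(** The partial derivative of the [i]-th component along the [j]-th axis. *)
Definition jacob (R : realType) (m n : nat) (f : 'rV[R]_m -> 'rV[R]_n)
    (x : 'rV[R]_m) (i : 'I_n) (j : 'I_m) : R := 'D_(delta_mx 0 j) f x 0 i.

(** * Smooth manifolds modelled on [V] *)

(** Both maps are total; only [cfwd] on [cdom] and [cbwd] on the image of
    [cdom] are meaningful. *)
Record chart (R : realType) (V : normedModType R) (X : topologicalType) := Chart {
  cdom : set X;
  cfwd : X -> V;
  cbwd : V -> X }.

Definition cimg (R : realType) (V : normedModType R) (X : topologicalType)
  (c : chart V X) : set V := cfwd c @` cdom c.

Definition is_chart (R : realType) (V : normedModType R) (X : topologicalType)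
    (c : chart V X) : Prop :=
  [/\ open (cdom c), open (cimg c),
      (forall x, cdom c x -> cbwd c (cfwd c x) = x),
      {within cdom c, continuous (cfwd c)} &
      {within cimg c, continuous (cbwd c)}].

Record manifold (R : realType) (V : normedModType R) := Manifold {
  mcarrier :> topologicalType;
  mhausdorff : hausdorff_space mcarrier;
  mcountable : @second_countable mcarrier;
  atlas : set (chart V mcarrier);
  atlas_chart : forall c, atlas c -> is_chart c;
  atlas_cover : forall x, exists2 c, atlas c & cdom c x;
  atlas_smooth : forall c c', atlas c -> atlas c' ->
    Cinf (cfwd c @` (cdom c `&` cdom c')) (cfwd c' \o cbwd c) }.

(** Smoothness of a real function on the open set [W]. *)
Definition smooth_on (R : realType) (V : normedModType R) (X : manifold V)
    (W : set X) (f : X -> R) : Prop :=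
  forall c, atlas c -> Cinf (cfwd c @` (W `&` cdom c)) (f \o cbwd c).

Definition smooth_at (R : realType) (V : normedModType R) (X : manifold V)
    (e : X) (f : X -> R) : Prop :=
  exists W : set X, [/\ open W, W e & smooth_on W f].

(** * Tangent vectors, vector fields, distributions *)

(** Tangent vectors at [e] are derivations of germs of smooth functions at
    [e].  They are represented by total functionals, so that the relevant
    equality is [tangent_eq], agreement on functions smooth at [e]. *)
Definition functional (R : realType) (X : Type) := (X -> R) -> R.

Definition tangent (R : realType) (V : normedModType R) (X : manifold V)
    (e : X) (v : functional R X) : Prop :=
  [/\ (forall f g, smooth_at e f -> smooth_at e g ->
         (\forall x \near e, f x = g x) -> v f = v g),
      (forall f g, smooth_at e f -> smooth_at e g ->
         v (fun x => f x + g x) = v f + v g),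
      (forall (a : R) f, smooth_at e f -> v (fun x => a * f x) = a * v f) &
      (forall f g, smooth_at e f -> smooth_at e g ->
         v (fun x => f x * g x) = v f * g e + f e * v g)].

Definition tangent_eq (R : realType) (V : normedModType R) (X : manifold V)
    (e : X) (v w : functional R X) : Prop :=
  forall f, smooth_at e f -> v f = w f.

(** A field of tangent vectors: [Z e f] is the derivative of [f] at [e]
    along [Z].  Fields are total; a field on the open set [W] is one
    satisfying [is_vfield W], its values outside [W] being irrelevant. *)
Definition vfield (R : realType) (X : Type) := X -> functional R X.

Definition is_vfield (R : realType) (V : normedModType R) (X : manifold V)
    (W : set X) (Z : vfield R X) : Prop :=
  (forall e, W e -> tangent e (Z e)) /\
  (forall (W' : set X) f, open W' -> W' `<=` W -> smooth_on W' f ->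
     smooth_on W' (fun e => Z e f)).

Definition vfield_eq (R : realType) (V : normedModType R) (X : manifold V)
    (W : set X) (Y Z : vfield R X) : Prop :=
  forall e, W e -> tangent_eq e (Y e) (Z e).

Definition vadd (R : realType) (X : Type) (Y Z : vfield R X) : vfield R X :=
  fun e f => Y e f + Z e f.

Definition vsub (R : realType) (X : Type) (Y Z : vfield R X) : vfield R X :=
  fun e f => Y e f - Z e f.

Definition vscale (R : realType) (X : Type) (h : X -> R) (Z : vfield R X) :
  vfield R X := fun e f => h e * Z e f.

Definition vcomb (R : realType) (X : Type) (I : finType) (h : I -> X -> R)
  (Z : I -> vfield R X) : vfield R X := fun e f => \sum_i h i e * Z i e f.

Definition bracket (R : realType) (X : Type) (Y Z : vfield R X) : vfield R X :=
  fun e f => Y e (fun x => Z x f) - Z e (fun x => Y x f).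

(** The field of directional derivatives along [v] in the chart [c]. *)
Definition coord_field (R : realType) (V : normedModType R) (X : manifold V)
    (c : chart V X) (v : V) : vfield R X :=
  fun e f => 'D_v (f \o cbwd c) (cfwd c e).

(** [v] lies in the span at [e] of the finite family [Z]. *)
Definition in_span (R : realType) (V : normedModType R) (X : manifold V)
    (I : finType) (Z : I -> vfield R X) (e : X) (v : functional R X) : Prop :=
  exists a : I -> R, tangent_eq e v (fun f => \sum_i a i * Z i e f).

Definition is_distribution (R : realType) (V : normedModType R)
    (X : manifold V) (r : nat) (N : X -> set (functional R X)) : Prop :=
  (forall e v, N e v -> tangent e v) /\
  (forall e0, exists (W : set X) (Z : 'I_r -> vfield R X),
     [/\ open W, W e0, (forall i, is_vfield W (Z i)),
         (forall e (a : 'I_r -> R), W e ->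
            tangent_eq e (fun f => \sum_i a i * Z i e f) (fun _ => 0) ->
            forall i, a i = 0) &
         (forall e v, W e -> tangent e v -> (N e v <-> in_span Z e v))]).

(** * Linear connections *)

(** A linear connection acts on local vector fields compatibly with
    restriction to smaller open sets; this is the usual operator on global
    fields together with its (unique) localizations. *)
Record is_connection (R : realType) (V : normedModType R) (X : manifold V)
    (D : vfield R X -> vfield R X -> vfield R X) : Prop := IsConnection {
  conn_vfield : forall (W : set X) Y Z, open W ->
    is_vfield W Y -> is_vfield W Z -> is_vfield W (D Y Z);
  conn_local : forall (W : set X) Y Y' Z Z', open W ->
    is_vfield W Y -> is_vfield W Y' -> is_vfield W Z -> is_vfield W Z' ->
    vfield_eq W Y Y' -> vfield_eq W Z Z' -> vfield_eq W (D Y Z) (D Y' Z');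
  conn_addl : forall (W : set X) Y Y' Z, open W ->
    is_vfield W Y -> is_vfield W Y' -> is_vfield W Z ->
    vfield_eq W (D (vadd Y Y') Z) (vadd (D Y Z) (D Y' Z));
  conn_scalel : forall (W : set X) h Y Z, open W ->
    smooth_on W h -> is_vfield W Y -> is_vfield W Z ->
    vfield_eq W (D (vscale h Y) Z) (vscale h (D Y Z));
  conn_addr : forall (W : set X) Y Z Z', open W ->
    is_vfield W Y -> is_vfield W Z -> is_vfield W Z' ->
    vfield_eq W (D Y (vadd Z Z')) (vadd (D Y Z) (D Y Z'));
  conn_leibniz : forall (W : set X) h Y Z, open W ->
    smooth_on W h -> is_vfield W Y -> is_vfield W Z ->
    vfield_eq W (D Y (vscale h Z))
      (vadd (vscale (fun e => Y e h) Z) (vscale h (D Y Z))) }.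

Definition curvature (R : realType) (X : Type)
    (D : vfield R X -> vfield R X -> vfield R X) (Y Z S : vfield R X) :
    vfield R X :=
  vsub (vsub (D Y (D Z S)) (D Z (D Y S))) (D (bracket Y Z) S).

(** * The dual 1-jet bundle *)

(** Coordinates (t, x, p), with p^a_i the entry [p a i]. *)
Notation jet_model R m n :=
  ('rV[R]_m * 'rV[R]_n * 'M[R]_(m, n))%type (only parsing).

(** E^* is determined, up to a unique isomorphism over T x M, by its induced
    charts, which trivialize the projection over the products of chart domains
    and change by the stated rule (linear in p, whence the vector bundle
    structure). *)
Record jet_dual (R : realType) (m n : nat) (T : manifold 'rV[R]_m)
    (M : manifold 'rV[R]_n) := JetDual {
  jet_tot :> manifold (jet_model R m n);
  jet_proj : jet_tot -> T * M;
  jet_chart : chart 'rV[R]_m T -> chart 'rV[R]_n M ->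
    chart (jet_model R m n) jet_tot;
  jet_atlas : forall cT cM, atlas cT -> atlas cM -> atlas (jet_chart cT cM);
  jet_dom : forall cT cM, atlas cT -> atlas cM ->
    cdom (jet_chart cT cM) = jet_proj @^-1` (cdom cT `*` cdom cM);
  jet_img : forall cT cM, atlas cT -> atlas cM ->
    cimg (jet_chart cT cM) = (cimg cT `*` cimg cM) `*` setT;
  jet_base : forall cT cM e, atlas cT -> atlas cM ->
    cdom (jet_chart cT cM) e ->
    (cfwd (jet_chart cT cM) e).1 =
      (cfwd cT (jet_proj e).1, cfwd cM (jet_proj e).2);
  jet_change : forall cT cM cT' cM' e,
    atlas cT -> atlas cM -> atlas cT' -> atlas cM' ->
    cdom (jet_chart cT cM) e -> cdom (jet_chart cT' cM') e ->
    forall a i, (cfwd (jet_chart cT' cM') e).2 a i =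
      \sum_j \sum_b
        jacob (cfwd cM \o cbwd cM') (cfwd cM' (jet_proj e).2) j i *
        jacob (cfwd cT' \o cbwd cT) (cfwd cT (jet_proj e).1) a b *
        (cfwd (jet_chart cT cM) e).2 b j }.

(** Index of a vertical direction: the pair (a, i) stands for the indices
    a and i of d/dp^a_i. *)
Notation vidx m n := ('I_m * 'I_n)%type.

Section Adapted.
Context {R : realType} {m n : nat} {T : manifold 'rV[R]_m}
  {M : manifold 'rV[R]_n}.
Implicit Types (E : jet_dual T M).

(** W = ker pi^*_*, using T(T x M) = TT x TM. *)
Definition vertical E (e : E) (v : functional R E) : Prop :=
  [/\ tangent e v,
      (forall g, smooth_at (jet_proj e).1 g ->
         v (fun x => g (jet_proj x).1) = 0) &
      (forall g, smooth_at (jet_proj e).2 g ->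
         v (fun x => g (jet_proj x).2) = 0)].

Record is_nonlinear_connection E (N : E -> set (functional R E)) : Prop :=
  IsNonlinearConnection {
    nlc_distribution : is_distribution (m + n)%N N;
    nlc_sum : forall e v, tangent e v -> exists h w,
      [/\ N e h, vertical e w & tangent_eq e v (fun f => h f + w f)];
    nlc_direct : forall e v, N e v -> vertical e v ->
      tangent_eq e v (fun _ => 0) }.

(** [N1 N (b, j) a] and [N2 N (b, j) i] are the local coefficients of the
    nonlinear connection. *)
Record ncoeffs (X : Type) := NCoeffs {
  N1 : vidx m n -> 'I_m -> X -> R;
  N2 : vidx m n -> 'I_n -> X -> R }.

Definition partial_t E (c : chart (jet_model R m n) E) (a : 'I_m) : vfield R E :=
  coord_field c (delta_mx 0 a, 0, 0).

Definition partial_x E (c : chart (jet_model R m n) E) (i : 'I_n) : vfield R E :=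
  coord_field c (0, delta_mx 0 i, 0).

Definition partial_p E (c : chart (jet_model R m n) E) (q : vidx m n) :
  vfield R E := coord_field c (0, 0, delta_mx q.1 q.2).

Definition delta_t E (c : chart (jet_model R m n) E) (nc : ncoeffs E)
    (a : 'I_m) : vfield R E :=
  vsub (partial_t c a) (vcomb (fun q => N1 nc q a) (partial_p c)).

Definition delta_x E (c : chart (jet_model R m n) E) (nc : ncoeffs E)
    (i : 'I_n) : vfield R E :=
  vsub (partial_x c i) (vcomb (fun q => N2 nc q i) (partial_p c)).

(** [nc] are the coefficients of [N] over the domain of [c]. *)
Definition is_ncoeffs E (N : E -> set (functional R E))
    (c : chart (jet_model R m n) E) (nc : ncoeffs E) : Prop :=
  [/\ (forall q a, smooth_on (cdom c) (N1 nc q a)),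
      (forall q i, smooth_on (cdom c) (N2 nc q i)) &
      (forall e v, cdom c e -> tangent e v ->
         (N e v <->
          in_span (fun s : 'I_m + 'I_n =>
            match s with inl a => delta_t c nc a | inr i => delta_x c nc i end)
            e v))].

(** The span of the delta/delta t^a (resp. delta/delta x^i) does not depend
    on the induced chart. *)
Definition horizontal_T E (N : E -> set (functional R E)) (e : E)
    (v : functional R E) : Prop :=
  tangent e v /\ exists cT cM nc,
    [/\ atlas cT, atlas cM, cdom (jet_chart E cT cM) e,
        is_ncoeffs N (jet_chart E cT cM) nc &
        in_span (delta_t (jet_chart E cT cM) nc) e v].

Definition horizontal_M E (N : E -> set (functional R E)) (e : E)
    (v : functional R E) : Prop :=
  tangent e v /\ exists cT cM nc,
    [/\ atlas cT, atlas cM, cdom (jet_chart E cT cM) e,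
        is_ncoeffs N (jet_chart E cT cM) nc &
        in_span (delta_x (jet_chart E cT cM) nc) e v].

Definition preserves E (D : vfield R E -> vfield R E -> vfield R E)
    (H : E -> set (functional R E)) : Prop :=
  forall (W : set E) Y Z, open W -> is_vfield W Y -> is_vfield W Z ->
    (forall e, W e -> H e (Z e)) -> forall e, W e -> H e (D Y Z e).

Definition is_Nlinear E (N : E -> set (functional R E))
    (D : vfield R E -> vfield R E -> vfield R E) : Prop :=
  [/\ is_connection D, preserves D (horizontal_T N),
      preserves D (horizontal_M N) & preserves D (@vertical E)].

(** Adapted coefficients.  The suffixes T, M, V indicate on which of the three
    distributions the coefficient acts.  Reading of the indices:
    [A_T a b c] = A^a_{bc}, [A_M i j c] = A^i_{jc},
    [A_V (a,i) (b,j) c] = A^{(a)(j)}_{(i)(b)c}, and likewise for H with a last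
    index k; [C_T a b (c,k)] = C^{a(k)}_{b(c)}, [C_M i j (c,k)] =
    C^{i(k)}_{j(c)}, [C_V (a,i) (b,j) (c,k)] = C^{(a)(j)(k)}_{(i)(b)(c)}. *)
Record dcoeffs (X : Type) := DCoeffs {
  A_T : 'I_m -> 'I_m -> 'I_m -> X -> R;
  A_M : 'I_n -> 'I_n -> 'I_m -> X -> R;
  A_V : vidx m n -> vidx m n -> 'I_m -> X -> R;
  H_T : 'I_m -> 'I_m -> 'I_n -> X -> R;
  H_M : 'I_n -> 'I_n -> 'I_n -> X -> R;
  H_V : vidx m n -> vidx m n -> 'I_n -> X -> R;
  C_T : 'I_m -> 'I_m -> vidx m n -> X -> R;
  C_M : 'I_n -> 'I_n -> vidx m n -> X -> R;
  C_V : vidx m n -> vidx m n -> vidx m n -> X -> R }.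

Record smooth_dcoeffs E (W : set E) (G : dcoeffs E) : Prop := SmoothDCoeffs {
  smooth_A_T : forall a b c, smooth_on W (A_T G a b c);
  smooth_A_M : forall i j c, smooth_on W (A_M G i j c);
  smooth_A_V : forall p q c, smooth_on W (A_V G p q c);
  smooth_H_T : forall a b k, smooth_on W (H_T G a b k);
  smooth_H_M : forall i j k, smooth_on W (H_M G i j k);
  smooth_H_V : forall p q k, smooth_on W (H_V G p q k);
  smooth_C_T : forall a b q, smooth_on W (C_T G a b q);
  smooth_C_M : forall i j q, smooth_on W (C_M G i j q);
  smooth_C_V : forall p q s, smooth_on W (C_V G p q s) }.

Record is_dcoeffs E (D : vfield R E -> vfield R E -> vfield R E)
    (c : chart (jet_model R m n) E) (nc : ncoeffs E) (G : dcoeffs E) : Prop :=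
  IsDCoeffs {
  dcoeffs_smooth : smooth_dcoeffs (cdom c) G;
  dcoeffs_A_T : forall g b, vfield_eq (cdom c)
    (D (delta_t c nc g) (delta_t c nc b))
    (vcomb (fun a => A_T G a b g) (delta_t c nc));
  dcoeffs_A_M : forall g j, vfield_eq (cdom c)
    (D (delta_t c nc g) (delta_x c nc j))
    (vcomb (fun i => A_M G i j g) (delta_x c nc));
  dcoeffs_A_V : forall g q, vfield_eq (cdom c)
    (D (delta_t c nc g) (partial_p c q))
    (vcomb (fun p e => - A_V G p q g e) (partial_p c));
  dcoeffs_H_T : forall k b, vfield_eq (cdom c)
    (D (delta_x c nc k) (delta_t c nc b))
    (vcomb (fun a => H_T G a b k) (delta_t c nc));
  dcoeffs_H_M : forall k j, vfield_eq (cdom c)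
    (D (delta_x c nc k) (delta_x c nc j))
    (vcomb (fun i => H_M G i j k) (delta_x c nc));
  dcoeffs_H_V : forall k q, vfield_eq (cdom c)
    (D (delta_x c nc k) (partial_p c q))
    (vcomb (fun p e => - H_V G p q k e) (partial_p c));
  dcoeffs_C_T : forall s b, vfield_eq (cdom c)
    (D (partial_p c s) (delta_t c nc b))
    (vcomb (fun a => C_T G a b s) (delta_t c nc));
  dcoeffs_C_M : forall s j, vfield_eq (cdom c)
    (D (partial_p c s) (delta_x c nc j))
    (vcomb (fun i => C_M G i j s) (delta_x c nc));
  dcoeffs_C_V : forall s q, vfield_eq (cdom c)
    (D (partial_p c s) (partial_p c q))
    (vcomb (fun p e => - C_V G p q s e) (partial_p c)) }.

(** Torsion components: [NR_tt (a,i) b c] = R^{(a)}_{(i)bc}, [NR_tx (a,i) b k]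
    = R^{(a)}_{(i)bk}, [NR_xx (a,i) j k] = R^{(a)}_{(i)jk}, [NP_t (f,r) a (b,j)]
    = P^{(f) (j)}_{(r)a(b)}, [NP_x (f,r) i (b,j)] = P^{(f) (j)}_{(r)i(b)}. *)
Definition NR_tt E (ch : chart (jet_model R m n) E) (nc : ncoeffs E)
    (q : vidx m n) (b c : 'I_m) (e : E) : R :=
  delta_t ch nc c e (N1 nc q b) - delta_t ch nc b e (N1 nc q c).

Definition NR_tx E (ch : chart (jet_model R m n) E) (nc : ncoeffs E)
    (q : vidx m n) (b : 'I_m) (k : 'I_n) (e : E) : R :=
  delta_x ch nc k e (N1 nc q b) - delta_t ch nc b e (N2 nc q k).

Definition NR_xx E (ch : chart (jet_model R m n) E) (nc : ncoeffs E)
    (q : vidx m n) (j k : 'I_n) (e : E) : R :=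
  delta_x ch nc k e (N2 nc q j) - delta_x ch nc j e (N2 nc q k).

Definition NP_t E (ch : chart (jet_model R m n) E) (nc : ncoeffs E)
    (G : dcoeffs E) (q : vidx m n) (a : 'I_m) (s : vidx m n) (e : E) : R :=
  partial_p ch s e (N1 nc q a) + A_V G q s a e.

Definition NP_x E (ch : chart (jet_model R m n) E) (nc : ncoeffs E)
    (G : dcoeffs E) (q : vidx m n) (i : 'I_n) (s : vidx m n) (e : E) : R :=
  partial_p ch s e (N2 nc q i) + H_V G q s i e.

(** ** Covariant derivatives of d-tensor components *)

(** The kinds of index slots of a d-tensor: T- and M-indices in upper or lower
    position, and vertical pairs, either (d) up and (l) down (as the components
    of a vector field along d/dp) or (k) up and (b) down (dual). *)
Inductive slot := Tup | Tdn | Mup | Mdn | Vup | Vdn.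

Definition slot_idx (s : slot) : finType :=
  match s with
  | Tup | Tdn => 'I_m
  | Mup | Mdn => 'I_n
  | Vup | Vdn => vidx m n
  end.

Fixpoint multi_idx (l : seq slot) : Type :=
  if l is s :: l' then (slot_idx s * multi_idx l')%type else unit.

(** [slot_coef ... s i j]: the factor, with its sign, of the term in which the
    index [i] of a slot of kind [s] has been replaced by the summation index
    [j]. *)
Definition slot_coef (X : Type) (LT : 'I_m -> 'I_m -> X -> R)
    (LM : 'I_n -> 'I_n -> X -> R) (LV : vidx m n -> vidx m n -> X -> R)
    (s : slot) : slot_idx s -> slot_idx s -> X -> R :=
  match s return slot_idx s -> slot_idx s -> X -> R with
  | Tup => fun i j e => LT i j e
  | Tdn => fun i j e => - LT j i e
  | Mup => fun i j e => LM i j e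
  | Mdn => fun i j e => - LM j i e
  | Vup => fun i j e => - LV i j e
  | Vdn => fun i j e => LV j i e
  end.

Fixpoint slot_terms (X : Type) (LT : 'I_m -> 'I_m -> X -> R)
    (LM : 'I_n -> 'I_n -> X -> R) (LV : vidx m n -> vidx m n -> X -> R)
    (l : seq slot) : (multi_idx l -> X -> R) -> multi_idx l -> X -> R :=
  match l return (multi_idx l -> X -> R) -> multi_idx l -> X -> R with
  | [::] => fun _ _ _ => 0
  | s :: l' => fun S I e =>
      \sum_j S (j, I.2) e * slot_coef LT LM LV I.1 j e +
      slot_terms LT LM LV (fun J => S (I.1, J)) I.2 e
  end.

(** S_{.../g} and S_{...|s}. *)
Definition cov_t E (c : chart (jet_model R m n) E) (nc : ncoeffs E)
    (G : dcoeffs E) (l : seq slot) (S : multi_idx l -> E -> R)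
    (I : multi_idx l) (g : 'I_m) (e : E) : R :=
  delta_t c nc g e (S I) +
  slot_terms (fun a b => A_T G a b g) (fun i j => A_M G i j g)
    (fun p q => A_V G p q g) S I e.

Definition cov_x E (c : chart (jet_model R m n) E) (nc : ncoeffs E)
    (G : dcoeffs E) (l : seq slot) (S : multi_idx l -> E -> R)
    (I : multi_idx l) (s : 'I_n) (e : E) : R :=
  delta_x c nc s e (S I) +
  slot_terms (fun a b => H_T G a b s) (fun i j => H_M G i j s)
    (fun p q => H_V G p q s) S I e.

(** The C coefficients as d-tensors. *)
Definition Cslots_T := [:: Tup; Tdn; Vdn].
Definition Cslots_M := [:: Mup; Mdn; Vdn].
Definition Cslots_V := [:: Vup; Vdn; Vdn].

Definition Ctensor_T (X : Type) (G : dcoeffs X) (I : multi_idx Cslots_T) :=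
  C_T G I.1 I.2.1 I.2.2.1.
Definition Ctensor_M (X : Type) (G : dcoeffs X) (I : multi_idx Cslots_M) :=
  C_M G I.1 I.2.1 I.2.2.1.
Definition Ctensor_V (X : Type) (G : dcoeffs X) (I : multi_idx Cslots_V) :=
  C_V G I.1 I.2.1 I.2.2.1.

(** [CT_cov_t d a (c,k) b] = C^{d(k)}_{a(c)/b}, [CT_cov_x d a (c,k) j] =
    C^{d(k)}_{a(c)|j}, etc. *)
Definition CT_cov_t E (ch : chart (jet_model R m n) E) nc G (d a : 'I_m)
  (s : vidx m n) := @cov_t E ch nc G Cslots_T (Ctensor_T G) (d, (a, (s, tt))).
Definition CT_cov_x E (ch : chart (jet_model R m n) E) nc G (d a : 'I_m)
  (s : vidx m n) := @cov_x E ch nc G Cslots_T (Ctensor_T G) (d, (a, (s, tt))).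
Definition CM_cov_t E (ch : chart (jet_model R m n) E) nc G (l i : 'I_n)
  (s : vidx m n) := @cov_t E ch nc G Cslots_M (Ctensor_M G) (l, (i, (s, tt))).
Definition CM_cov_x E (ch : chart (jet_model R m n) E) nc G (l i : 'I_n)
  (s : vidx m n) := @cov_x E ch nc G Cslots_M (Ctensor_M G) (l, (i, (s, tt))).
Definition CV_cov_t E (ch : chart (jet_model R m n) E) nc G (p q : vidx m n)
  (s : vidx m n) := @cov_t E ch nc G Cslots_V (Ctensor_V G) (p, (q, (s, tt))).
Definition CV_cov_x E (ch : chart (jet_model R m n) E) nc G (p q : vidx m n)
  (s : vidx m n) := @cov_x E ch nc G Cslots_V (Ctensor_V G) (p, (q, (s, tt))).

(** ** Curvature components *)

(** First suffix: the distribution acted on; second suffix: the pair of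
    directions, written in the order of the last two lower indices of the
    d-tensor (so that [RT_tx d a b k] = R^d_{abk} comes from the curvature
    operator on (delta/delta x^k, delta/delta t^b)).  The vertical index pairs
    are ordered as in [dcoeffs]: [RV_tt (d,l) (a,i) b c] =
    R^{(d)(i)}_{(l)(a)bc}. *)
Record curv_comps (X : Type) := CurvComps {
  RT_tt : 'I_m -> 'I_m -> 'I_m -> 'I_m -> X -> R;
  RT_tx : 'I_m -> 'I_m -> 'I_m -> 'I_n -> X -> R;
  PT_tp : 'I_m -> 'I_m -> 'I_m -> vidx m n -> X -> R;
  RT_xx : 'I_m -> 'I_m -> 'I_n -> 'I_n -> X -> R;
  PT_xp : 'I_m -> 'I_m -> 'I_n -> vidx m n -> X -> R;
  ST_pp : 'I_m -> 'I_m -> vidx m n -> vidx m n -> X -> R;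
  RM_tt : 'I_n -> 'I_n -> 'I_m -> 'I_m -> X -> R;
  RM_tx : 'I_n -> 'I_n -> 'I_m -> 'I_n -> X -> R;
  PM_tp : 'I_n -> 'I_n -> 'I_m -> vidx m n -> X -> R;
  RM_xx : 'I_n -> 'I_n -> 'I_n -> 'I_n -> X -> R;
  PM_xp : 'I_n -> 'I_n -> 'I_n -> vidx m n -> X -> R;
  SM_pp : 'I_n -> 'I_n -> vidx m n -> vidx m n -> X -> R;
  RV_tt : vidx m n -> vidx m n -> 'I_m -> 'I_m -> X -> R;
  RV_tx : vidx m n -> vidx m n -> 'I_m -> 'I_n -> X -> R;
  PV_tp : vidx m n -> vidx m n -> 'I_m -> vidx m n -> X -> R;
  RV_xx : vidx m n -> vidx m n -> 'I_n -> 'I_n -> X -> R;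
  PV_xp : vidx m n -> vidx m n -> 'I_n -> vidx m n -> X -> R;
  SV_pp : vidx m n -> vidx m n -> vidx m n -> vidx m n -> X -> R }.

Record is_curv_comps E (D : vfield R E -> vfield R E -> vfield R E)
    (ch : chart (jet_model R m n) E) (nc : ncoeffs E) (K : curv_comps E) :
    Prop := IsCurvComps {
  curv_RT_tt : forall a b c, vfield_eq (cdom ch)
    (curvature D (delta_t ch nc c) (delta_t ch nc b) (delta_t ch nc a))
    (vcomb (fun d => RT_tt K d a b c) (delta_t ch nc));
  curv_RT_tx : forall a b k, vfield_eq (cdom ch)
    (curvature D (delta_x ch nc k) (delta_t ch nc b) (delta_t ch nc a))
    (vcomb (fun d => RT_tx K d a b k) (delta_t ch nc));
  curv_PT_tp : forall a b s, vfield_eq (cdom ch)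
    (curvature D (partial_p ch s) (delta_t ch nc b) (delta_t ch nc a))
    (vcomb (fun d => PT_tp K d a b s) (delta_t ch nc));
  curv_RT_xx : forall a j k, vfield_eq (cdom ch)
    (curvature D (delta_x ch nc k) (delta_x ch nc j) (delta_t ch nc a))
    (vcomb (fun d => RT_xx K d a j k) (delta_t ch nc));
  curv_PT_xp : forall a j s, vfield_eq (cdom ch)
    (curvature D (partial_p ch s) (delta_x ch nc j) (delta_t ch nc a))
    (vcomb (fun d => PT_xp K d a j s) (delta_t ch nc));
  curv_ST_pp : forall a u s, vfield_eq (cdom ch)
    (curvature D (partial_p ch s) (partial_p ch u) (delta_t ch nc a))
    (vcomb (fun d => ST_pp K d a u s) (delta_t ch nc));
  curv_RM_tt : forall i b c, vfield_eq (cdom ch)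
    (curvature D (delta_t ch nc c) (delta_t ch nc b) (delta_x ch nc i))
    (vcomb (fun l => RM_tt K l i b c) (delta_x ch nc));
  curv_RM_tx : forall i b k, vfield_eq (cdom ch)
    (curvature D (delta_x ch nc k) (delta_t ch nc b) (delta_x ch nc i))
    (vcomb (fun l => RM_tx K l i b k) (delta_x ch nc));
  curv_PM_tp : forall i b s, vfield_eq (cdom ch)
    (curvature D (partial_p ch s) (delta_t ch nc b) (delta_x ch nc i))
    (vcomb (fun l => PM_tp K l i b s) (delta_x ch nc));
  curv_RM_xx : forall i j k, vfield_eq (cdom ch)
    (curvature D (delta_x ch nc k) (delta_x ch nc j) (delta_x ch nc i))
    (vcomb (fun l => RM_xx K l i j k) (delta_x ch nc));
  curv_PM_xp : forall i j s, vfield_eq (cdom ch)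
    (curvature D (partial_p ch s) (delta_x ch nc j) (delta_x ch nc i))
    (vcomb (fun l => PM_xp K l i j s) (delta_x ch nc));
  curv_SM_pp : forall i u s, vfield_eq (cdom ch)
    (curvature D (partial_p ch s) (partial_p ch u) (delta_x ch nc i))
    (vcomb (fun l => SM_pp K l i u s) (delta_x ch nc));
  curv_RV_tt : forall q b c, vfield_eq (cdom ch)
    (curvature D (delta_t ch nc c) (delta_t ch nc b) (partial_p ch q))
    (vcomb (fun p e => - RV_tt K p q b c e) (partial_p ch));
  curv_RV_tx : forall q b k, vfield_eq (cdom ch)
    (curvature D (delta_x ch nc k) (delta_t ch nc b) (partial_p ch q))
    (vcomb (fun p e => - RV_tx K p q b k e) (partial_p ch));
  curv_PV_tp : forall q b s, vfield_eq (cdom ch)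
    (curvature D (partial_p ch s) (delta_t ch nc b) (partial_p ch q))
    (vcomb (fun p e => - PV_tp K p q b s e) (partial_p ch));
  curv_RV_xx : forall q j k, vfield_eq (cdom ch)
    (curvature D (delta_x ch nc k) (delta_x ch nc j) (partial_p ch q))
    (vcomb (fun p e => - RV_xx K p q j k e) (partial_p ch));
  curv_PV_xp : forall q j s, vfield_eq (cdom ch)
    (curvature D (partial_p ch s) (delta_x ch nc j) (partial_p ch q))
    (vcomb (fun p e => - PV_xp K p q j s e) (partial_p ch));
  curv_SV_pp : forall q u s, vfield_eq (cdom ch)
    (curvature D (partial_p ch s) (partial_p ch u) (partial_p ch q))
    (vcomb (fun p e => - SV_pp K p q u s e) (partial_p ch)) }.

End Adapted.

(* Main.v *)
Require Import Defs.
From HB Require Import structures.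
From mathcomp Require Import all_boot all_order all_algebra.
From mathcomp Require Import all_classical all_reals all_analysis.
From mathcomp Require Import ring lra.
Import Order.TTheory GRing.Theory Num.Theory numFieldNormedType.Exports.
Local Open Scope classical_set_scope.
Local Open Scope ring_scope.

(** The argument is the classical computation of curvature in a frame.  Let Z
    be one of the three families spanning a distribution that D preserves (the
    delta/delta t, the delta/delta x or the d/dp), and let Y, S be two fields
    of the adapted frame.  If D_Y Z_b = L^d_b Z_d and D_S Z_b = L'^d_b Z_d,
    two applications of the Leibniz rule give
      D_Y D_S Z_b - D_S D_Y Z_b
        = (Y L'^d_b - S L^d_b + L'^f_b L^d_f - L^f_b L'^d_f) Z_d,
    so that only D_[Y,S] Z_b remains.  The bracket of any two fields of the
    adapted frame is vertical, [Y,S] = - T^q d/dp^q, where T is one of the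
    curvatures R of the nonlinear connection, a derivative dN/dp, or zero;
    hence - D_[Y,S] Z_b = T^q C^d_(b q) Z_d.  This is [curvature_frame].  For a
    pair (d/dp, delta) the derivative dN/dp is the torsion P minus an A or H
    coefficient, and that coefficient, together with the derivative of C and
    the two quadratic terms, makes up the covariant derivative of C.  Finally
    each family is linearly independent, so the components of a field along
    it are unique: the formulas hold if and only if the given functions are the
    components of the curvature ([curvature_frameP], and [curvature_frameNP]
    for the opposite signs used along d/dp).

    The brackets rest on one analytic fact: coordinate fields commute
    ([coord_field_comm]), which is the symmetry of second derivatives
    ([derive_comm]), proved by applying the mean value theorem twice to a second
    difference.  With the fields delta = P - n_q Q_q, where P and the
    Q_q = d/dp^q are coordinate fields, [bracket_sub_vcomb] then yields all
    brackets ([bracket_coord_adapted], [bracket_adapted]).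

    A connection only acts on fields that are smooth in every chart, so the
    frame fields must be shown to be such.  This needs smoothness of the
    composite of a function with a change of charts, which follows from the
    chain rule written in linear coordinates ([derive_comp_coords], [Ck_comp]): it
    expresses a derivative of the composite by sums and products of functions
    of the same class.  Linear independence is seen by applying the fields to
    the coordinate functions t^a, x^i, p^a_i, on which each family takes
    Kronecker delta values. *)

Set Implicit Arguments.
Unset Strict Implicit.
Unset Printing Implicit Defensive.

(** * Calculus of C^k maps *)

Section DifferentiableClosure.
Context {R : realType} {V W : normedModType R}.

(** The derivative is a chosen linear map, so that differentiability has to be
    transferred through the uniqueness of first order expansions. *)
Lemma near_eq_differentiable (f g : V -> W) (x : V) :
  (\forall y \near x, f y = g y) -> differentiable f x -> differentiable g x.
Proof.
move=> fg /diff_locallyP[cf ef].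
have eg : g \o shift x = cst (g x) + 'd f x +o_ 0 id.
  apply/eqaddoP => _/posnumP[e].
  move/eqaddoP : ef => /(_ e%:num (ltac:(by []))).
  have fg0 : \forall h \near 0, f (h + x) = g (h + x).
    have := fg; rewrite (near_shift 0 x); apply: filterS => h /=.
    by rewrite subr0.
  apply: filterS2 fg0 => h /= fgh.
  rewrite /= -![(_ - _ : _ -> _) _]/(_ - _) /=.
  by rewrite -![(_ + _ : _ -> _) _]/(_ + _) /= fgh (nbhs_singleton fg).
apply/diff_locallyP; rewrite (diff_unique cf eg); split => //.
Qed.

Lemma Ck_eq (U : set V) (f g : V -> W) k : open U ->
  (forall x, U x -> f x = g x) -> Ck k U f -> Ck k U g.
Proof.
move=> oU; elim: k f g => [|k IH] f g fg /=.
  move=> cf x Ux; have near_fg : \forall y \near x, f y = g y.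
    by apply: filterS (open_nbhs_nbhs (conj oU Ux)) => y /fg.
  rewrite /prop_for /continuous_at -(fg _ Ux).
  exact: cvg_trans (near_eq_cvg near_fg) (cf x Ux).
move=> [df Df]; have near_fg x : U x -> \forall y \near x, f y = g y.
  by move=> Ux; apply: filterS (open_nbhs_nbhs (conj oU Ux)) => y /fg.
split=> [x Ux|v]; first exact: near_eq_differentiable (near_fg x Ux) (df x Ux).
by apply: IH (Df v) => x Ux; apply/near_eq_derive/near_fg.
Qed.

Lemma Ck_sub (U U' : set V) (f : V -> W) k : U' `<=` U -> Ck k U f -> Ck k U' f.
Proof.
move=> UU; elim: k f => [|k IH] f /=; first by move=> cf x /UU/cf.
by move=> [df Df]; split=> [x /UU/df //|v]; apply: IH.
Qed.

Lemma Ck_pred (U : set V) (f : V -> W) k : Ck k.+1 U f -> Ck k U f.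
Proof.
elim: k f => [|k IH] f [df Df]; first by move=> x /df /differentiable_continuous.
by split=> // v; apply: IH.
Qed.

Lemma Ck_cst (U : set V) (a : W) k : Ck k U (fun=> a).
Proof.
elim: k a => [|k IH] a /=; first by move=> x _; exact: cvg_cst.
split=> [x _|v]; first exact: differentiable_cst.
by have -> : 'D_v (fun=> a) = (fun=> 0) by apply/funext => x; exact: derive_cst.
Qed.

Lemma CkD (U : set V) (f g : V -> W) k : open U ->
  Ck k U f -> Ck k U g -> Ck k U (fun x => f x + g x).
Proof.
move=> oU; elim: k f g => [|k IH] f g /=.
  by move=> cf cg x Ux; apply: cvgD; [exact: cf|exact: cg].
move=> [df Df] [dg Dg]; split=> [x Ux|v].
  by apply: differentiableD; [exact: df|exact: dg].
apply: Ck_eq (IH _ _ (Df v) (Dg v)) => // x Ux.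
by rewrite -[RHS]/('D_v (f + g) x) deriveD //; apply: diff_derivable; auto.
Qed.

Lemma Ck_sum (U : set V) (I : Type) (s : seq I) (f : I -> V -> W) k : open U ->
  (forall i, Ck k U (f i)) -> Ck k U (fun x => \sum_(i <- s) f i x).
Proof.
move=> oU Cf; elim: s => [|i s IH].
  by apply: Ck_eq (Ck_cst U 0 k) => // x _; rewrite big_nil.
by apply: Ck_eq (CkD oU (Cf i) IH) => // x _; rewrite big_cons.
Qed.

End DifferentiableClosure.

Section ScalarClosure.
Context {R : realType} {V : normedModType R}.

(** The product rule leaves f itself as a factor next to a derivative of g, so
    the induction on k needs f to be of class C^k as well ([Ck_pred]). *)
Lemma CkM (U : set V) (f g : V -> R) k : open U ->
  Ck k U f -> Ck k U g -> Ck k U (fun x => f x * g x).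
Proof.
move=> oU; elim: k f g => [|k IH] f g.
  by move=> cf cg x Ux; apply: cvgM; [exact: cf|exact: cg].
move=> Cf Cg; have := Cf; have := Cg; case=> dg Dg; case=> df Df.
split=> [x Ux|v]; first by apply: differentiableM; auto.
have Cfg := CkD oU (IH _ _ (Ck_pred Cf) (Dg v)) (IH _ _ (Ck_pred Cg) (Df v)).
apply: Ck_eq Cfg => //.
move=> x Ux.
by rewrite -[RHS]/('D_v (f * g) x) deriveM //; apply: diff_derivable; auto.
Qed.

Lemma Ck_linear_comp (W : normedModType R) (l : {linear V -> W})
    (Z : normedModType R) (U : set Z) (f : Z -> V) k :
  continuous l -> open U -> Ck k U f -> Ck k U (fun x => l (f x)).
Proof.
move=> cl oU; elim: k f => [|k IH] f.
  by move=> cf x Ux; apply: continuous_comp; [exact: cf|exact: cl].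
move=> [df Df]; split=> [x Ux|v].
  by apply: (@differentiable_comp _ _ _ _ f l); auto; exact: linear_differentiable.
apply: Ck_eq (IH _ (Df v)) => // x Ux.
rewrite -[RHS]/('D_v (l \o f) x) !deriveE; auto; last first.
  by apply: differentiable_comp; auto; exact: linear_differentiable.
have dl := linear_differentiable (f x) cl.
by rewrite (diff_comp (df x Ux) dl) /= (diff_lin (f x) cl).
Qed.

End ScalarClosure.

(** * Chain rule in coordinates and symmetry of second derivatives *)

(** Continuous linear coordinates: the form in which finite dimension is used,
    both for the chain rule and for the duality with coordinate fields. *)
Record linear_coords (R : realType) (V : normedModType R) (I : finType) :=
  LinearCoords {
    lbase : I -> V;
    lcoord : I -> {linear V -> R^o};
    lcoord_continuous : forall i, continuous (lcoord i);
    lcoord_expand : forall v, v = \sum_i lcoord i v *: lbase i }.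

Section Composition.
Context {R : realType} {V V' : normedModType R} {I : finType}.
Variable B : linear_coords V' I.

Lemma derive_comp_coords (f : V -> V') (g : V' -> R) (x v : V) :
  differentiable f x -> differentiable g (f x) ->
  'D_v (g \o f) x =
    \sum_i lcoord B i ('D_v f x) * 'D_(lbase B i) g (f x).
Proof.
move=> df dg; rewrite deriveE; last exact: differentiable_comp.
rewrite (diff_comp df dg) /= -(deriveE v df).
rewrite [X in 'd g _ X = _](lcoord_expand B) linear_sum; apply: eq_bigr => i _.
by rewrite linearZ /= (deriveE _ dg).
Qed.

(** By the chain rule the derivatives of the composite are sums of products
    of a coordinate of a derivative of f and of a derivative of g composed
    with f; the induction hypothesis applies to the latter. *)
Lemma Ck_comp (U : set V) (U' : set V') (f : V -> V') (g : V' -> R) k :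
  open U -> open U' -> (forall x, U x -> U' (f x)) ->
  Ck k U f -> Ck k U' g -> Ck k U (g \o f).
Proof.
move=> oU oU' UU'; elim: k g => [|k IH] g.
  by move=> cf cg x Ux; apply: continuous_comp; [exact: cf|apply: cg; exact: UU'].
move=> Cf Cg; case: (Cf) => df Df; case: (Cg) => dg Dg; split=> [x Ux|v].
  by apply: differentiable_comp; auto.
have C : Ck k U (fun x =>
    \sum_i lcoord B i ('D_v f x) * 'D_(lbase B i) g (f x)).
  apply: Ck_sum => // i; apply: CkM => //.
    apply: Ck_linear_comp => //; [exact: lcoord_continuous|exact: Df].
  by apply: (IH ('D_(lbase B i) g)); [exact: Ck_pred|exact: Dg].
by apply: Ck_eq C => // x Ux; rewrite derive_comp_coords //; auto.
Qed.

End Composition.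

Section SymmetryOfSecondDerivatives.
Context {R : realType} {V : normedModType R}.

(** The difference quotients of g along v and of its restriction to the line are
    the same function. *)
Lemma is_derive_line (g : V -> R) (y v : V) (s : R) :
  differentiable g (y + s *: v) ->
  is_derive s 1 (fun t : R => g (y + t *: v)) ('D_v g (y + s *: v)).
Proof.
move=> dg; have dv := diff_derivable (v := v) dg.
have E : (fun h : R => h^-1 *:
      (((fun t : R => g (y + t *: v)) \o shift s) (h *: 1) - g (y + s *: v))) =
    (fun h : R => h^-1 *:
      ((g \o shift (y + s *: v)) (h *: v) - g (y + s *: v))).
  apply/funext => h /=; congr (_ *: (g _ - _)).
  by rewrite -[h *: 1]/(h * 1) mulr1 scalerDl addrCA.
by split; rewrite /derivable /derive E.
Qed.

Lemma MVT_line (g : V -> R) (y v : V) (h : R) : 0 < h ->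
  (forall s, 0 <= s <= h -> differentiable g (y + s *: v)) ->
  exists2 s, 0 <= s <= h & g (y + h *: v) - g y = 'D_v g (y + s *: v) * h.
Proof.
move=> h0 dg.
have [||s sh E] := @MVT R (fun t => g (y + t *: v))
    (fun t => 'D_v g (y + t *: v)) 0 h h0.
- move=> s; rewrite in_itv /= => /andP[s0 sh]; apply: is_derive_line.
  by apply: dg; rewrite !ltW.
- apply: derivable_within_continuous => s; rewrite in_itv /= => sh.
  by have [] := is_derive_line (dg s sh).
exists s; first by move: sh; rewrite in_itv /= => /andP[? ?]; rewrite !ltW.
by move: E; rewrite scale0r addr0 subr0.
Qed.

(** The mean value theorem is applied first to g z = f (z + h w) - f z along v,
    then to the derivative of f along v, in the direction w. *)
Lemma second_difference (f : V -> R) (U : set V) (x v w : V) (h : R) : 0 < h ->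
  (forall s t, 0 <= s <= h -> 0 <= t <= h -> U (x + s *: v + t *: w)) ->
  Ck 2 U f ->
  exists s t, [/\ 0 <= s <= h, 0 <= t <= h &
    f (x + h *: v + h *: w) - f (x + h *: v) - f (x + h *: w) + f x =
      'D_w (fun z => 'D_v f z) (x + s *: v + t *: w) * h * h].
Proof.
move=> h0 Uxst [df /(_ v)[ddf _]].
have hh : 0 <= h <= h by rewrite lexx ltW.
have h00 : 0 <= (0 : R) <= h by rewrite lexx ltW.
pose g z := f (z + h *: w) - f z.
have dsh z : differentiable f (z + h *: w) ->
    differentiable (fun y => f (y + h *: w)) z.
  by move=> dfz; apply: (@differentiable_comp _ _ _ _ (fun y => y + h *: w) f).
have dg s : 0 <= s <= h -> differentiable g (x + s *: v).
  move=> sh; apply: differentiableB.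
    by apply/dsh/df/Uxst.
  by apply: df; rewrite -[_ + _]addr0 -(scale0r w); exact: Uxst.
have [s sh Es] := MVT_line h0 dg.
have Eg : 'D_v g (x + s *: v) =
    'D_v f (x + s *: v + h *: w) - 'D_v f (x + s *: v).
  have d1 : differentiable f (x + s *: v + h *: w) by apply/df/Uxst.
  have d2 : differentiable f (x + s *: v).
    by apply: df; rewrite -[_ + _]addr0 -(scale0r w); exact: Uxst.
  rewrite -[LHS]/('D_v ((fun y => f (y + h *: w)) - f) (x + s *: v)).
  rewrite (deriveB (diff_derivable (dsh _ d1)) (diff_derivable d2)).
  congr (_ - _); rewrite /derive.
  set q1 := (fun t : R => _); set q2 := (fun t : R => _).
  by have -> : q1 = q2 by apply/funext => t; rewrite /q1 /q2 /= [in RHS]addrA.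
have [t th Et] : exists2 t, 0 <= t <= h &
   'D_v f (x + s *: v + h *: w) - 'D_v f (x + s *: v) =
     'D_w (fun z => 'D_v f z) (x + s *: v + t *: w) * h.
  by apply: (MVT_line h0) => t th; apply/ddf/Uxst.
exists s, t; split=> //; rewrite -Et -Eg -Es /g [x + h *: v + _]addrAC; ring.
Qed.

(** The second difference is symmetric in v and w, so [second_difference]
    equates a value of D_w D_v f with a value of D_v D_w f at points arbitrarily close
    to x; continuity of both at x concludes. *)
Lemma derive_comm (f : V -> R) (U : set V) (x v w : V) : open U -> U x ->
  Ck 2 U f ->
  'D_w (fun z => 'D_v f z) x = 'D_v (fun z => 'D_w f z) x.
Proof.
move=> oU Ux C2.
have cont v' w' : {for x, continuous ('D_w' (fun z => 'D_v' f z))}.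
  by case: C2 => _ /(_ v')[_ /(_ w')]; exact.
apply/eqP; rewrite -subr_eq0; apply/negPn/negP => nz.
pose A z := 'D_w (fun z => 'D_v f z) z; pose A' z := 'D_v (fun z => 'D_w f z) z.
have {}nz : A x - A' x != 0 by exact: nz.
pose e := `|A x - A' x| / 2.
have e0 : 0 < e by rewrite divr_gt0 // normr_gt0.
have nA : \forall y \near x, `|A x - A y| < e.
  by have /cvgrPdist_lt/(_ e e0) : {for x, continuous A} := cont v w.
have nA' : \forall y \near x, `|A' x - A' y| < e.
  by have /cvgrPdist_lt/(_ e e0) : {for x, continuous A'} := cont w v.
have nU := open_nbhs_nbhs (conj oU Ux).
have /nbhs_ballP[r /= r0 Br] : nbhs x
    [set y | [/\ `|A x - A y| < e, `|A' x - A' y| < e & U y]].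
  by apply: filterS3 nA nA' nU => y.
(* Makes the parallelogram of sides h v, h w at x lie in the ball. *)
pose h := r / (`|v| + `|w| + 1).
have vw0 : 0 < `|v| + `|w| + 1 by rewrite ltr_wpDl // addr_ge0.
have h0 : 0 < h by rewrite divr_gt0.
have inB s t v' w' : `|v'| + `|w'| = `|v| + `|w| ->
    0 <= s <= h -> 0 <= t <= h -> ball x r (x + s *: v' + t *: w').
  move=> Evw /andP[s0 sh] /andP[t0 th].
  rewrite -ball_normE /= -addrA opprD addrA subrr add0r normrN.
  apply: le_lt_trans (ler_normD _ _) _; rewrite !normrZ !ger0_norm //.
  have : h * (`|v| + `|w|) < r.
    rewrite /h mulrAC ltr_pdivrMr // ltr_pM2l //; lra.
  apply: le_lt_trans; rewrite -Evw mulrDr.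
  by apply: lerD; rewrite ler_wpM2r.
have sub : ball x r `<=` U by move=> y /Br[].
have [s [t [sh th E1]]] := second_difference h0
  (fun s t sh th => inB s t v w erefl sh th) (Ck_sub sub C2).
have [s' [t' [sh' th' E2]]] := second_difference h0
  (fun s t sh th => inB s t w v (addrC _ _) sh th) (Ck_sub sub C2).
have EA : A (x + s *: v + t *: w) = A' (x + s' *: w + t' *: v).
  have hn : h != 0 by rewrite gt_eqF.
  apply/(mulIf hn)/(mulIf hn); rewrite -E1 -E2 [x + h *: v + _]addrAC; ring.
have [lt1 _ _] := Br _ (inB _ _ _ _ erefl sh th).
have [_ lt2 _] := Br _ (inB _ _ _ _ (addrC _ _) sh' th').
have : `|A x - A' x| < e + e.
  have -> : A x - A' x = (A x - A (x + s *: v + t *: w))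
     - (A' x - A' (x + s' *: w + t' *: v)) by rewrite EA; ring.
  exact: le_lt_trans (ler_normB _ _) (ltrD lt1 lt2).
by rewrite /e -splitr ltxx.
Qed.

End SymmetryOfSecondDerivatives.

(** * Smooth functions and coordinate fields on a manifold *)

Section SmoothFunctions.
Context {R : realType} {V : normedModType R} {X : manifold V}.
Implicit Types (c : chart V X) (W : set X) (f g : X -> R) (e : X).

Lemma chart_bwd_fwd c e : atlas c -> cdom c e -> cbwd c (cfwd c e) = e.
Proof. by move=> /atlas_chart[_ _ + _ _]; exact. Qed.

Lemma chart_open c : atlas c -> open (cdom c).
Proof. by case/atlas_chart. Qed.

Lemma open_chart_image c W : atlas c -> open W ->
  open (cfwd c @` (W `&` cdom c)).
Proof.
move=> /atlas_chart[od oi K _ cb] oW.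
have -> : cfwd c @` (W `&` cdom c) =
    cimg c `&` cbwd c @^-1` (W `&` cdom c).
  apply/seteqP; split=> y.
    by move=> [x [Wx dx] <-]; split; [exists x|rewrite /= K].
  move=> [[x dx <-]]; rewrite /= K // => -[Wx _]; by exists x.
move: cb; rewrite (continuous_open_subspace _ oi).
by move=> /(continuous_inP _ oi); apply; exact: openI.
Qed.

Lemma chart_bwd_continuous c e : atlas c -> cdom c e ->
  {for cfwd c e, continuous (cbwd c)}.
Proof.
move=> /atlas_chart[od oi K _ cb] de.
move: cb; rewrite (continuous_open_subspace _ oi); apply.
by rewrite inE; exists e.
Qed.

Lemma near_chart c e (P : set X) : atlas c -> cdom c e ->
  (\forall x \near e, P x) -> \forall y \near cfwd c e, P (cbwd c y).
Proof.
move=> ac de; rewrite -{1}(chart_bwd_fwd ac de) => Pe.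
exact: (chart_bwd_continuous ac de).
Qed.

Lemma smooth_on_sub W W' f : W' `<=` W -> smooth_on W f -> smooth_on W' f.
Proof.
move=> WW sf c ac k; apply: Ck_sub (sf c ac k) => y [x [Wx dx] <-].
by exists x => //; split=> //; exact: WW.
Qed.

Lemma smooth_on_eq W f g : open W -> (forall x, W x -> f x = g x) ->
  smooth_on W f -> smooth_on W g.
Proof.
move=> oW fg sf c ac k; apply: Ck_eq (sf c ac k); first exact: open_chart_image.
by move=> y [x [Wx dx] <-]; rewrite /= chart_bwd_fwd ?fg.
Qed.

Lemma smooth_on_cst W (a : R) : smooth_on W (fun=> a).
Proof. by move=> c ac k; exact: Ck_cst. Qed.

Lemma smooth_onD W f g : open W -> smooth_on W f -> smooth_on W g ->
  smooth_on W (fun x => f x + g x).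
Proof.
move=> oW sf sg c ac k; apply: CkD (sf c ac k) (sg c ac k).
exact: open_chart_image.
Qed.

Lemma smooth_onM W f g : open W -> smooth_on W f -> smooth_on W g ->
  smooth_on W (fun x => f x * g x).
Proof.
move=> oW sf sg c ac k; apply: CkM (sf c ac k) (sg c ac k).
exact: open_chart_image.
Qed.

Lemma smooth_onN W f : open W -> smooth_on W f -> smooth_on W (fun x => - f x).
Proof.
move=> oW sf; apply: smooth_on_eq oW _ (smooth_onM oW (smooth_on_cst W (-1)) sf).
by move=> x _; rewrite mulN1r.
Qed.

Lemma smooth_onB W f g : open W -> smooth_on W f -> smooth_on W g ->
  smooth_on W (fun x => f x - g x).
Proof. by move=> oW sf sg; apply: smooth_onD => //; exact: smooth_onN. Qed.

Lemma smooth_on_sum W (J : Type) (s : seq J) (f : J -> X -> R) : open W ->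
  (forall i, smooth_on W (f i)) -> smooth_on W (fun x => \sum_(i <- s) f i x).
Proof.
move=> oW sf c ac k; apply: (@Ck_sum _ _ _ _ _ _ (fun i => f i \o cbwd c)).
  exact: open_chart_image.
by move=> i; exact: sf.
Qed.

Lemma smooth_on_at W f e : open W -> W e -> smooth_on W f -> smooth_at e f.
Proof. by move=> *; exists W. Qed.

Lemma smooth_at_in W f e : open W -> W e -> smooth_at e f ->
  exists W', [/\ open W', W' e, W' `<=` W & smooth_on W' f].
Proof.
move=> oW We [W' [oW' We' sf]]; exists (W' `&` W); split => //.
  exact: openI.
by apply: smooth_on_sub sf => x [].
Qed.

Lemma smooth_at2 f g e : smooth_at e f -> smooth_at e g ->
  exists W, [/\ open W, W e, smooth_on W f & smooth_on W g].
Proof.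
move=> sf [W [oW We sg]]; have [W' [oW' We' WW sf']] := smooth_at_in oW We sf.
by exists W'; split=> //; exact: smooth_on_sub sg.
Qed.

Lemma smooth_atD f g e : smooth_at e f -> smooth_at e g ->
  smooth_at e (fun x => f x + g x).
Proof.
move=> sf sg; have [W [oW We s1 s2]] := smooth_at2 sf sg.
by exists W; split=> //; exact: smooth_onD.
Qed.

Lemma smooth_atM f g e : smooth_at e f -> smooth_at e g ->
  smooth_at e (fun x => f x * g x).
Proof.
move=> sf sg; have [W [oW We s1 s2]] := smooth_at2 sf sg.
by exists W; split=> //; exact: smooth_onM.
Qed.

Lemma smooth_at_cst (a : R) e : smooth_at e (fun=> a).
Proof. by exists setT; split=> //; [exact: openT|exact: smooth_on_cst]. Qed.

Lemma smooth_at_sum (J : Type) (s : seq J) (f : J -> X -> R) e :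
  (forall i, smooth_at e (f i)) -> smooth_at e (fun x => \sum_(i <- s) f i x).
Proof.
move=> sf; elim: s => [|i s IH].
  have -> : (fun x => \sum_(i <- [::]) f i x) = (fun=> 0).
    by apply/funext => x; rewrite big_nil.
  exact: smooth_at_cst.
have -> : (fun x => \sum_(j <- i :: s) f j x) =
    (fun x => f i x + \sum_(j <- s) f j x).
  by apply/funext => x; rewrite big_cons.
exact: smooth_atD.
Qed.

Lemma smooth_at_chart c f e : atlas c -> cdom c e -> smooth_at e f ->
  exists U, [/\ open U, U (cfwd c e) & Cinf U (f \o cbwd c)].
Proof.
move=> ac de [W [oW We sf]]; exists (cfwd c @` (W `&` cdom c)); split.
- exact: open_chart_image.
- by exists e.
- exact: sf.
Qed.

Lemma smooth_at_differentiable c f e : atlas c -> cdom c e -> smooth_at e f ->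
  differentiable (f \o cbwd c) (cfwd c e).
Proof.
by move=> ac de /(smooth_at_chart ac de)[U [_ Ue /(_ 1%N)[+ _]]]; exact.
Qed.

Section WithCoordinates.
Context {I : finType} (B : linear_coords V I).

(** Smoothness is required in all charts; a single chart around W suffices since
    changes of charts are smooth. *)
Lemma smooth_on_chart c W f : atlas c -> open W -> W `<=` cdom c ->
  Cinf (cfwd c @` W) (f \o cbwd c) -> smooth_on W f.
Proof.
move=> ac oW Wc Cf c' ac' k.
have WE : W = W `&` cdom c by apply/esym/setIidPl.
have oU := open_chart_image ac' oW.
have Ctr : Ck k (cfwd c' @` (W `&` cdom c')) (cfwd c \o cbwd c').
  apply: Ck_sub (atlas_smooth ac' ac k) => y [x [Wx dx] <-].
  by exists x => //; split=> //; exact: Wc.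
have oU' : open (cfwd c @` W) by rewrite WE; exact: open_chart_image ac oW.
apply: Ck_eq (Ck_comp B oU oU' _ Ctr (Cf k)) => // y [x [Wx dx] <-] /=.
  by rewrite !chart_bwd_fwd //; exact: Wc.
by rewrite chart_bwd_fwd //; exists x.
Qed.

Lemma smooth_on_coord c i : atlas c ->
  smooth_on (cdom c) (fun x => lcoord B i (cfwd c x)).
Proof.
move=> ac; have oc := chart_open ac; apply: (smooth_on_chart ac oc) => // k.
have oU : open (cfwd c @` cdom c).
  by rewrite -[cdom c]setIid; exact: open_chart_image.
have Cid : Ck k (cfwd c @` cdom c) (cfwd c \o cbwd c).
  by apply: Ck_sub (atlas_smooth ac ac k); rewrite setIid.
by apply: Ck_linear_comp Cid => //; exact: lcoord_continuous.
Qed.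

Lemma coord_field_tangent c v e : atlas c -> cdom c e ->
  tangent e (coord_field c v e).
Proof.
move=> ac de; have df f sf := @smooth_at_differentiable c f e ac de sf.
have K := chart_bwd_fwd ac de.
split; rewrite /coord_field.
- by move=> f g _ _ fg; apply/near_eq_derive/(near_chart ac de fg).
- move=> f g /df dcf /df dcg.
  rewrite -[LHS]/('D_v ((f \o cbwd c) + (g \o cbwd c)) (cfwd c e)).
  by rewrite deriveD //; exact: diff_derivable.
- move=> a f /df dcf.
  rewrite -[LHS]/('D_v (a \*: (f \o cbwd c)) (cfwd c e)).
  by rewrite deriveZ //; exact: diff_derivable.
- move=> f g /df dcf /df dcg.
  rewrite -[LHS]/('D_v ((f \o cbwd c) * (g \o cbwd c)) (cfwd c e)).
  rewrite deriveM; [|exact: diff_derivable..].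
  by rewrite /= !K addrC mulrC [X in _ + X]mulrC -[X in X + _ = _]/(_ * _).
Qed.

Lemma coord_field_vfield c v : atlas c -> is_vfield (cdom c) (coord_field c v).
Proof.
move=> ac; split=> [e de|W f oW Wc sf]; first exact: coord_field_tangent.
have WE : W = W `&` cdom c by apply/esym/setIidPl.
apply: (smooth_on_chart ac oW Wc) => k.
have oU : open (cfwd c @` W) by rewrite WE; exact: open_chart_image ac oW.
have := sf c ac k.+1; rewrite -WE => -[_ /(_ v)]; apply: Ck_eq => //.
by move=> _ [x Wx <-] /=; rewrite /coord_field chart_bwd_fwd //; exact: Wc.
Qed.

End WithCoordinates.

Lemma coord_field_comm c v w f e : atlas c -> cdom c e -> smooth_at e f ->
  coord_field c v e (fun x => coord_field c w x f) =
  coord_field c w e (fun x => coord_field c v x f).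
Proof.
move=> ac de sf; have [U [oU Ue Cf]] := smooth_at_chart ac de sf.
have E u : \forall y \near cfwd c e,
    ((fun x => coord_field c u x f) \o cbwd c) y = 'D_u (f \o cbwd c) y.
  have oi := open_chart_image ac (@openT X); rewrite setTI in oi.
  have : nbhs (cfwd c e) (cfwd c @` cdom c).
    by apply: open_nbhs_nbhs; split => //; exists e.
  by apply: filterS => _ [x dx <-] /=; rewrite /coord_field chart_bwd_fwd.
rewrite /coord_field (near_eq_derive v (E w)) (near_eq_derive w (E v)).
exact: derive_comm oU Ue (Cf 2).
Qed.

End SmoothFunctions.

(** * Tangent vectors, vector fields and their brackets *)

Section TangentVectors.
Context {R : realType} {V : normedModType R} {X : manifold V}.
Implicit Types (W : set X) (f g : X -> R) (e : X) (v w : functional R X).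

(** The product rule at 1 * 1 = 1 kills the constant 1. *)
Lemma tangent_cst e v (a : R) : tangent e v -> v (fun=> a) = 0.
Proof.
move=> [_ _ vZ vM]; have s1 := smooth_at_cst 1 e.
have v1 : v (fun=> 1) = 0.
  have := vM _ _ s1 s1; rewrite (_ : (fun=> 1 * 1) = fun=> 1); last first.
    by apply/funext => x; rewrite mulr1.
  by rewrite mulr1 mul1r => /esym/eqP; rewrite -subr_eq0 addrK => /eqP.
rewrite (_ : (fun=> a) = (fun x : X => a * (fun=> 1) x)); last first.
  by apply/funext => x; rewrite mulr1.
by rewrite vZ // v1 mulr0.
Qed.

Lemma tangentB e v f g : tangent e v -> smooth_at e f -> smooth_at e g ->
  v (fun x => f x - g x) = v f - v g.
Proof.
move=> [_ vD vZ _] sf sg.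
rewrite (_ : (fun x => f x - g x) = (fun x => f x + (-1) * g x)); last first.
  by apply/funext => x; rewrite mulN1r.
by rewrite vD ?vZ ?mulN1r //; apply: smooth_atM => //; exact: smooth_at_cst.
Qed.

Lemma tangentN (e : X) v (f : X -> R) : tangent e v -> smooth_at e f ->
  v (fun x => - f x) = - v f.
Proof.
move=> tv sf; rewrite -[RHS]add0r -(tangent_cst 0 tv).
rewrite -(tangentB tv) //; last exact: smooth_at_cst.
by congr v; apply/funext => x; rewrite sub0r.
Qed.

Lemma tangent_sumM e v (J : Type) (s : seq J) (h g : J -> X -> R) :
  tangent e v -> (forall i, smooth_at e (h i)) ->
  (forall i, smooth_at e (g i)) ->
  v (fun x => \sum_(i <- s) h i x * g i x) =
  \sum_(i <- s) (v (h i) * g i e + h i e * v (g i)).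
Proof.
move=> tv sh sg; have [_ vD _ vM] := tv; elim: s => [|i s IH].
  rewrite big_nil (_ : (fun x => _) = fun=> 0) ?(tangent_cst _ tv) //.
  by apply/funext => x; rewrite big_nil.
rewrite big_cons -IH -vM // -vD.
- by congr v; apply/funext => x; rewrite big_cons.
- exact: smooth_atM.
- by apply: smooth_at_sum => j; exact: smooth_atM.
Qed.

Lemma tangent_comb e (J : Type) (s : seq J) (a : J -> R)
    (v : J -> functional R X) :
  (forall i, tangent e (v i)) ->
  tangent e (fun f => \sum_(i <- s) a i * v i f).
Proof.
move=> tv; split=> [f g sf sg fg|f g sf sg|b f sf|f g sf sg].
- by apply: eq_bigr => i _; have [vE _ _ _] := tv i; rewrite (vE f g).
- rewrite -big_split /=; apply: eq_bigr => i _; have [_ vD _ _] := tv i.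
  by rewrite vD // mulrDr.
- rewrite big_distrr /=; apply: eq_bigr => i _; have [_ _ vZ _] := tv i.
  by rewrite vZ //; ring.
- rewrite big_distrl big_distrr -big_split /=; apply: eq_bigr => i _.
  by have [_ _ _ vM] := tv i; rewrite vM //; ring.
Qed.

Lemma tangent_eq_tangent e v w : tangent e v -> tangent_eq e v w -> tangent e w.
Proof.
move=> [vE vD vZ vM] vw; split=> [f g sf sg fg|f g sf sg|b f sf|f g sf sg].
- by rewrite -!vw //; exact: vE.
- by rewrite -!vw ?vD //; exact: smooth_atD.
- by rewrite -!vw ?vZ //; apply: smooth_atM => //; exact: smooth_at_cst.
- by rewrite -!vw ?vM //; exact: smooth_atM.
Qed.

End TangentVectors.

Section VectorFields.
Context {R : realType} {V : normedModType R} {X : manifold V}.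
Implicit Types (W : set X) (f g : X -> R) (e : X) (Y Z : vfield R X).

Lemma vfield_eq_sym W Y Z : vfield_eq W Y Z -> vfield_eq W Z Y.
Proof. by move=> YZ e We f sf; rewrite YZ. Qed.

Lemma vfield_smooth_at W Z e f : open W -> W e -> is_vfield W Z ->
  smooth_at e f -> smooth_at e (fun x => Z x f).
Proof.
move=> oW We [_ sZ] sf; have [W' [oW' We' WW sf']] := smooth_at_in oW We sf.
by exists W'; split=> //; exact: sZ.
Qed.

(** Fields are represented by functionals on all functions, so being a
    vector field has to be transported along agreement on smooth functions. *)
Lemma vfield_eq_vfield W Y Z : is_vfield W Y -> vfield_eq W Y Z -> is_vfield W Z.
Proof.
move=> [tY sY] YZ; split=> [e We|W' f oW' WW sf].
  exact: tangent_eq_tangent (tY e We) (YZ e We).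
apply: smooth_on_eq (sY W' f oW' WW sf) => // e We.
by apply: YZ; [exact: WW|exact: smooth_on_at sf].
Qed.

Lemma vfield_comb W (J : Type) (s : seq J) (h : J -> X -> R)
    (Z : J -> vfield R X) :
  (forall i, smooth_on W (h i)) -> (forall i, is_vfield W (Z i)) ->
  is_vfield W (fun e f => \sum_(i <- s) h i e * Z i e f).
Proof.
move=> sh vZ; split=> [e We|W' f oW' WW sf].
  by apply: tangent_comb => i; have [tZ _] := vZ i; exact: tZ.
apply: smooth_on_sum => // i; apply: smooth_onM => //.
  exact: smooth_on_sub (sh i).
by have [_ sZ] := vZ i; exact: sZ.
Qed.

Lemma vfield_vcomb W (J : finType) (h : J -> X -> R) (Z : J -> vfield R X) :
  (forall i, smooth_on W (h i)) -> (forall i, is_vfield W (Z i)) ->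
  is_vfield W (vcomb h Z).
Proof. exact: vfield_comb. Qed.

Lemma vfield_scale W h Z : smooth_on W h -> is_vfield W Z ->
  is_vfield W (vscale h Z).
Proof.
move=> sh vZ.
apply: (vfield_eq_vfield (vfield_comb [:: tt] (fun=> sh) (fun=> vZ))).
by move=> e We f _; rewrite big_seq1.
Qed.

Lemma vfield_sub W Y Z : is_vfield W Y -> is_vfield W Z -> is_vfield W (vsub Y Z).
Proof.
move=> vY vZ.
pose YZ (b : bool) := if b then Y else Z.
pose h (b : bool) (x : X) : R := if b then 1 else -1.
have := @vfield_comb W bool [:: true; false] h YZ.
move=> /(_ (fun b => _) (fun b => _)) vYZ.
apply: (vfield_eq_vfield (vYZ _ _)) => [b|b|e We f _].
- by case: b; exact: smooth_on_cst.
- by case: b.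
- by rewrite big_cons big_seq1 /= mul1r mulN1r.
Qed.

End VectorFields.

Section Brackets.
Context {R : realType} {V : normedModType R} {X : manifold V}.
Implicit Types (f : X -> R) (e : X) (Y Z P : vfield R X).
Context {J : finType}.

(** The Leibniz rule of the bracket in its second argument, for a field of the
    shape of delta/delta t or delta/delta x. *)
Lemma bracket_sub_vcomb (W : set X) Y P (n : J -> X -> R) (Q : J -> vfield R X)
    e f : open W -> W e -> is_vfield W Y -> is_vfield W P ->
  (forall q, is_vfield W (Q q)) -> (forall q, smooth_on W (n q)) ->
  smooth_at e f ->
  bracket Y (vsub P (vcomb n Q)) e f =
  bracket Y P e f -
  \sum_q (Y e (n q) * Q q e f + n q e * bracket Y (Q q) e f).
Proof.
move=> oW We vY vP vQ sn sf; rewrite /bracket.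
have tY : tangent e (Y e) by case: vY => tY _; exact: tY.
have sQ q : smooth_at e (fun x => Q q x f) by exact: (vfield_smooth_at oW We).
have sn' q : smooth_at e (n q) by exact: smooth_on_at (sn q).
have := @tangentB _ _ _ e (Y e) (fun x => P x f) (fun x => vcomb n Q x f) tY.
rewrite /vsub => ->; last 2 first.
- exact: (vfield_smooth_at oW We).
- by apply: smooth_at_sum => q; exact: smooth_atM.
rewrite /vcomb (tangent_sumM _ tY sn' sQ).
rewrite [in RHS](eq_bigr (fun q => (Y e (n q) * Q q e f +
  n q e * Y e (fun x => Q q x f)) - n q e * Q q e (fun x => Y x f))).
  by rewrite sumrB; ring.
by move=> q _; ring.
Qed.

Variables (c : chart V X) (ac : atlas c).
Let U := cdom c.
Let oU : open U := chart_open ac.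
Variables (I : finType) (B : linear_coords V I) (u : J -> V).
Let Q q : vfield R X := coord_field c (u q).
Let vcf v : is_vfield U (coord_field c v) := coord_field_vfield B v ac.

Lemma vfield_sub_vcomb (v : V) (n : J -> X -> R) :
  (forall q, smooth_on U (n q)) ->
  is_vfield U (vsub (coord_field c v) (vcomb n Q)).
Proof. move=> sn; apply: vfield_sub; first exact: vcf.
by apply: vfield_vcomb => // q; exact: vcf. Qed.

Lemma bracket_coord (v w : V) e f : U e -> smooth_at e f ->
  bracket (coord_field c v) (coord_field c w) e f = 0.
Proof. by move=> Ue sf; rewrite /bracket (coord_field_comm v w ac) ?subrr. Qed.

(** Only the derivatives of the coefficients n_q survive, as coordinate fields
    commute. *)
Lemma bracket_coord_adapted (v w : V) (n : J -> X -> R) :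
  (forall q, smooth_on U (n q)) ->
  vfield_eq U (bracket (coord_field c w) (vsub (coord_field c v) (vcomb n Q)))
    (vcomb (fun q e => - coord_field c w e (n q)) Q).
Proof.
move=> sn e Ue f sf; rewrite (bracket_sub_vcomb (W := U)) //; last first.
  by move=> q; exact: vcf.
rewrite bracket_coord // sub0r -sumrN; apply: eq_bigr => q _.
by rewrite bracket_coord // mulr0 addr0 mulNr.
Qed.

(** Expanding dw = w - n'_q Q_q leaves brackets of dv with coordinate fields,
    known from [bracket_coord_adapted]; the terms n'_q Q_q(n_s) they produce complete
    the derivative of n_s along the coordinate field w to its derivative
    along dw. *)
Lemma bracket_adapted (v w : V) (n n' : J -> X -> R) :
  (forall q, smooth_on U (n q)) -> (forall q, smooth_on U (n' q)) ->
  let dv := vsub (coord_field c v) (vcomb n Q) in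
  let dw := vsub (coord_field c w) (vcomb n' Q) in
  vfield_eq U (bracket dv dw)
    (vcomb (fun q e => - (dv e (n' q) - dw e (n q))) Q).
Proof.
move=> sn sn' dv dw e Ue f sf.
have vdv : is_vfield U dv by exact: vfield_sub_vcomb.
have anti Y Z : bracket Y Z e f = - bracket Z Y e f.
  by rewrite /bracket opprB.
rewrite /dw (bracket_sub_vcomb (W := U)) //; last by move=> q; exact: vcf.
have dvE z : bracket dv (coord_field c z) e f =
    \sum_s coord_field c z e (n s) * Q s e f.
  rewrite anti (bracket_coord_adapted v z sn Ue sf) -sumrN.
  by apply: eq_bigr => s _; rewrite mulNr opprK.
rewrite dvE [X in _ - X](eq_bigr (fun q => dv e (n' q) * Q q e f +
    \sum_s n' q e * (Q q e (n s) * Q s e f))); last first.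
  by move=> q _; rewrite dvE big_distrr.
rewrite big_split exchange_big -big_split -sumrB /=; apply: eq_bigr => s _.
rewrite -/dw /dw /vsub /vcomb (eq_bigr (fun q => (n' q e * Q q e (n s)) * Q s e f)).
  by rewrite -big_distrl /=; ring.
by move=> q _; rewrite mulrA.
Qed.

End Brackets.

(** * Curvature of a connection in a frame *)

Section Curvature.
Context {R : realType} {V : normedModType R} {X : manifold V}.
Variable D : vfield R X -> vfield R X -> vfield R X.
Hypothesis hD : is_connection D.
Variables (W : set X) (oW : open W).
Implicit Types (Y Z S : vfield R X).

(** The axioms of a connection speak of binary sums and scalings; the zero field
    is reached as 0 times a field, which starts the induction for finite sums. *)
Lemma conn_zerol Z : is_vfield W Z ->
  vfield_eq W (D (fun _ _ => 0) Z) (fun _ _ => 0).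
Proof.
move=> vZ e We f sf.
have E : vfield_eq W (fun _ _ => 0) (vscale (fun=> 0) Z).
  by move=> x _ g _; rewrite /vscale mul0r.
have vs := vfield_scale (smooth_on_cst W 0) vZ.
have v0' : is_vfield W (fun _ _ => 0) := vfield_eq_vfield vs (vfield_eq_sym E).
rewrite (conn_local hD oW v0' vs vZ vZ E (fun _ _ _ _ => erefl) We sf).
rewrite (conn_scalel hD oW (smooth_on_cst W 0) vZ vZ We sf).
by rewrite /vscale mul0r.
Qed.

Lemma conn_combl (J : finType) (h : J -> X -> R) (P : J -> vfield R X) Z :
  (forall i, smooth_on W (h i)) -> (forall i, is_vfield W (P i)) ->
  is_vfield W Z ->
  vfield_eq W (D (vcomb h P) Z) (vcomb h (fun i => D (P i) Z)).
Proof.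
move=> sh vP vZ; rewrite /vcomb; elim: (index_enum J) => [|j s IH].
  move=> e We f sf; rewrite big_nil.
  apply: etrans (conn_zerol vZ We sf); congr (D _ Z e f).
  by apply/funext => x; apply/funext => g; rewrite big_nil.
move=> e We f sf; rewrite big_cons -(IH e We f sf).
have vs := vfield_scale (sh j) (vP j).
have vc := vfield_comb s sh vP.
rewrite -[h j e * _]/(vscale (h j) (D (P j) Z) e f).
rewrite -(conn_scalel hD oW (sh j) (vP j) vZ We sf).
rewrite -[RHS]/(vadd _ _ e f) -(conn_addl hD oW vs vc vZ We sf).
congr (D _ Z e f).
by apply/funext => x; apply/funext => g; rewrite big_cons.
Qed.

Lemma conn_zeror Y : is_vfield W Y ->
  vfield_eq W (D Y (fun _ _ => 0)) (fun _ _ => 0).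
Proof.
move=> vY e We f sf.
have E : vfield_eq W (fun _ _ => 0) (vscale (fun=> 0) Y).
  by move=> x _ g _; rewrite /vscale mul0r.
have vs := vfield_scale (smooth_on_cst W 0) vY.
have v0' : is_vfield W (fun _ _ => 0) := vfield_eq_vfield vs (vfield_eq_sym E).
rewrite (conn_local hD oW vY vY v0' vs (fun _ _ _ _ => erefl) E We sf).
rewrite (conn_leibniz hD oW (smooth_on_cst W 0) vY vY We sf).
have [tY _] := vY.
by rewrite /vadd /vscale (tangent_cst _ (tY e We)) !mul0r addr0.
Qed.

Lemma conn_combr (J : finType) (h : J -> X -> R) (Z : J -> vfield R X) Y :
  (forall i, smooth_on W (h i)) -> (forall i, is_vfield W (Z i)) ->
  is_vfield W Y ->
  vfield_eq W (D Y (vcomb h Z))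
    (fun e f => \sum_i (Y e (h i) * Z i e f + h i e * D Y (Z i) e f)).
Proof.
move=> sh vZ vY; rewrite /vcomb; elim: (index_enum J) => [|j s IH].
  move=> e We f sf; rewrite big_nil.
  apply: etrans (conn_zeror vY We sf); congr (D Y _ e f).
  by apply/funext => x; apply/funext => g; rewrite big_nil.
move=> e We f sf; rewrite big_cons -(IH e We f sf).
have vs := vfield_scale (sh j) (vZ j).
have vc := vfield_comb s sh vZ.
rewrite -[_ + _ * _]/(vadd (vscale (fun e => Y e (h j)) (Z j))
  (vscale (h j) (D Y (Z j))) e f).
rewrite -(conn_leibniz hD oW (sh j) vY (vZ j) We sf).
rewrite -[RHS]/(vadd _ _ e f) -(conn_addr hD oW vY vs vc We sf).
congr (D Y _ e f).
by apply/funext => x; apply/funext => g; rewrite big_cons.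
Qed.

Definition frame_free (I : finType) (Z : I -> vfield R X) :=
  forall e, W e -> forall a : I -> R,
  tangent_eq e (fun f => \sum_i a i * Z i e f) (fun=> 0) -> forall i, a i = 0.

Lemma frame_coeff_eq (I : finType) (Z : I -> vfield R X) F
    (g h : I -> X -> R) : frame_free Z -> vfield_eq W F (vcomb g Z) ->
  vfield_eq W F (vcomb h Z) <-> forall e, W e -> forall i, h i e = g i e.
Proof.
move=> free FE; split=> [FE' e We i|E e We f sf].
  apply/eqP; rewrite -subr_eq0; apply/eqP; move: i; apply: (free e We) => f sf.
  under eq_bigr do rewrite mulrBl.
  by rewrite sumrB -[X in X - _]/(vcomb h Z e f) -FE' // FE // subrr.
by rewrite (FE e We f sf); apply: eq_bigr => i _; rewrite E.
Qed.

Section Components.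
Variables (I J : finType) (Z : I -> vfield R X) (P : J -> vfield R X).
Hypotheses (vZ : forall i, is_vfield W (Z i)) (vP : forall q, is_vfield W (P q)).
Hypothesis Zfree : frame_free Z.
Variables (Y S : vfield R X) (LY LS : I -> I -> X -> R).
Variable C : I -> I -> J -> X -> R.
Variable T : J -> X -> R.
Hypotheses (vY : is_vfield W Y) (vS : is_vfield W S).
Hypotheses (sLY : forall a b, smooth_on W (LY a b))
  (sLS : forall a b, smooth_on W (LS a b)) (sT : forall q, smooth_on W (T q)).
Hypothesis DY : forall b, vfield_eq W (D Y (Z b)) (vcomb (fun a => LY a b) Z).
Hypothesis DS : forall b, vfield_eq W (D S (Z b)) (vcomb (fun a => LS a b) Z).
Hypothesis DP : forall q b,
  vfield_eq W (D (P q) (Z b)) (vcomb (fun a => C a b q) Z).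
Hypothesis YS : vfield_eq W (bracket Y S) (vcomb (fun q e => - T q e) P).

(** The second covariant derivative of a frame field, by the Leibniz rule. *)
Let conn_conn (Y' S' : vfield R X) (L L' : I -> I -> X -> R) :
  is_vfield W Y' -> is_vfield W S' ->
  (forall a b, smooth_on W (L' a b)) ->
  (forall b, vfield_eq W (D Y' (Z b)) (vcomb (fun a => L a b) Z)) ->
  (forall b, vfield_eq W (D S' (Z b)) (vcomb (fun a => L' a b) Z)) ->
  forall b, vfield_eq W (D Y' (D S' (Z b)))
   (vcomb (fun d e => Y' e (L' d b) + \sum_f L' f b e * L d f e) Z).
Proof.
move=> vY' vS' sL' DY' DS' b e We f sf.
have vc : is_vfield W (vcomb (fun a => L' a b) Z) by apply: vfield_vcomb.
rewrite (conn_local hD oW vY' vY' (conn_vfield hD oW vS' (vZ b)) vc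
  (fun _ _ _ _ => erefl) (DS' b) We sf).
rewrite conn_combr // big_split /=.
rewrite [X in _ + X](eq_bigr
  (fun i => \sum_d L' i b e * L d i e * Z d e f)); last first.
  move=> i _; rewrite DY' // /vcomb big_distrr; apply: eq_bigr => d _ /=.
  by rewrite mulrA.
rewrite exchange_big -big_split /vcomb /=; apply: eq_bigr => d _.
by rewrite mulrDl big_distrl.
Qed.

(** The commutator of second covariant derivatives gives the first four terms;
    the bracket, expanded along P, gives the last one. *)
Lemma curvature_frame b :
  vfield_eq W (curvature D Y S (Z b))
    (vcomb (fun d e => Y e (LS d b) - S e (LY d b)
      + \sum_f LS f b e * LY d f e - \sum_f LY f b e * LS d f e
      + \sum_q C d b q e * T q e) Z).
Proof.
move=> e We f sf; rewrite /curvature /vsub.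
rewrite (conn_conn vY vS sLS DY DS) // (conn_conn vS vY sLY DS DY) //.
have sT' q : smooth_on W (fun x => - T q x) by exact: smooth_onN.
have vc : is_vfield W (vcomb (fun q e => - T q e) P) by apply: vfield_vcomb.
have vB := vfield_eq_vfield vc (vfield_eq_sym YS).
rewrite (conn_local hD oW vB vc (vZ b) (vZ b) YS (fun _ _ _ _ => erefl) We sf).
rewrite conn_combl // /vcomb.
rewrite [X in _ - X](eq_bigr (fun q => \sum_d - (C d b q e * T q e * Z d e f))).
  rewrite exchange_big -sumrN -big_split -sumrN -big_split /=.
  apply: eq_bigr => d _; rewrite sumrN opprK -big_distrl /=; ring.
move=> q _; rewrite DP // /vcomb big_distrr; apply: eq_bigr => d _ /=; ring.
Qed.

Lemma curvature_frameP b (k : I -> X -> R) :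
  vfield_eq W (curvature D Y S (Z b)) (vcomb k Z) <->
  forall e, W e -> forall d, k d e = Y e (LS d b) - S e (LY d b)
      + \sum_f LS f b e * LY d f e - \sum_f LY f b e * LS d f e
      + \sum_q C d b q e * T q e.
Proof. exact: frame_coeff_eq Zfree (curvature_frame b). Qed.

End Components.
End Curvature.

Section CurvatureOppositeSign.
Context {R : realType} {V : normedModType R} {X : manifold V}.

(** The coefficients along d/dp are defined with a minus sign.  The linear terms
    and the left-hand side then change sign while the quadratic terms do not,
    which is why LY and LS trade places in them. *)
Lemma curvature_frameNP (D : vfield R X -> vfield R X -> vfield R X)
  (hD : is_connection D) (W : set X) (oW : open W) (I J : finType)
  (Z : I -> vfield R X) (P : J -> vfield R X)
  (vZ : forall i, is_vfield W (Z i)) (vP : forall q, is_vfield W (P q))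
  (Zfree : frame_free W Z)
  (Y S : vfield R X) (LY LS : I -> I -> X -> R) (C : I -> I -> J -> X -> R)
  (T : J -> X -> R) (vY : is_vfield W Y) (vS : is_vfield W S)
  (sLY : forall a b, smooth_on W (LY a b))
  (sLS : forall a b, smooth_on W (LS a b)) (sT : forall q, smooth_on W (T q))
  (DY : forall b, vfield_eq W (D Y (Z b)) (vcomb (fun a e => - LY a b e) Z))
  (DS : forall b, vfield_eq W (D S (Z b)) (vcomb (fun a e => - LS a b e) Z))
  (DP : forall q b,
    vfield_eq W (D (P q) (Z b)) (vcomb (fun a e => - C a b q e) Z))
  (YS : vfield_eq W (bracket Y S) (vcomb (fun q e => - T q e) P))
  b (k : I -> X -> R) :
  vfield_eq W (curvature D Y S (Z b)) (vcomb (fun d e => - k d e) Z) <->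
  forall e, W e -> forall d, k d e = Y e (LS d b) - S e (LY d b)
      + \sum_f LS d f e * LY f b e - \sum_f LY d f e * LS f b e
      + \sum_q C d b q e * T q e.
Proof.
have sLY' a c : smooth_on W (fun e => - LY a c e) by exact: smooth_onN.
have sLS' a c : smooth_on W (fun e => - LS a c e) by exact: smooth_onN.
apply: iff_trans (curvature_frameP hD oW vZ vP Zfree
  (LY := fun a c e => - LY a c e)
  (LS := fun a c e => - LS a c e) (C := fun a c q e => - C a c q e)
  vY vS sLY' sLS' sT DY DS DP YS b (fun d e => - k d e)) _.
have E e d : W e -> Y e (fun x => - LS d b x) - S e (fun x => - LY d b x)
      + \sum_f - LS f b e * - LY d f e - \sum_f - LY f b e * - LS d f e
      + \sum_q - C d b q e * T q e =
    - (Y e (LS d b) - S e (LY d b)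
      + \sum_f LS d f e * LY f b e - \sum_f LY d f e * LS f b e
      + \sum_q C d b q e * T q e).
  move=> We; have [tY _] := vY; have [tS _] := vS.
  have sY := smooth_on_at oW We (sLS d b).
  have sS := smooth_on_at oW We (sLY d b).
  rewrite (tangentN (tY e We) sY) (tangentN (tS e We) sS).
  under eq_bigr do rewrite mulrNN mulrC.
  under [X in _ - X + _]eq_bigr do rewrite mulrNN mulrC.
  under [X in _ + X]eq_bigr do rewrite mulNr.
  by rewrite sumrN; ring.
split=> H e We d; first by apply: oppr_inj; rewrite (H e We d) (E e d We).
by rewrite (E e d We) (H e We d).
Qed.

End CurvatureOppositeSign.

(** * The adapted frame of the dual 1-jet bundle *)

Section DualFunctions.
Context {R : realType} {V : normedModType R} {X : manifold V}.

(** Read in the chart, the coordinate function is linear, hence its own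
    derivative. *)
Lemma coord_field_coord (I : finType) (B : linear_coords V I) (c : chart V X)
    v i e : atlas c -> cdom c e ->
  coord_field c v e (fun x => lcoord B i (cfwd c x)) = lcoord B i v.
Proof.
move=> ac de; rewrite /coord_field.
have E : \forall y \near cfwd c e,
    ((fun x => lcoord B i (cfwd c x)) \o cbwd c) y = lcoord B i y.
  have oi := open_chart_image ac (@openT X); rewrite setTI in oi.
  have : nbhs (cfwd c e) (cfwd c @` cdom c).
    by apply: open_nbhs_nbhs; split => //; exists e.
  by apply: filterS => _ [x dx <-] /=; rewrite chart_bwd_fwd.
rewrite (near_eq_derive v E) deriveE.
  by rewrite diff_lin //; exact: lcoord_continuous.
by apply: linear_differentiable; exact: lcoord_continuous.
Qed.

Lemma dual_frame_free (W : set X) (I : finType) (Z : I -> vfield R X)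
    (phi : I -> X -> R) : open W -> (forall i, smooth_on W (phi i)) ->
  (forall e i j, W e -> Z i e (phi j) = (i == j)%:R) -> frame_free W Z.
Proof.
move=> oW sphi dual e We a a0 i; have := a0 (phi i) (smooth_on_at oW We (sphi i)).
rewrite (bigD1 i) //= big1 => [|j ji]; rewrite dual ?eqxx ?(negbTE ji) //.
  by rewrite mulr1 addr0.
by rewrite mulr0.
Qed.

End DualFunctions.

Section JetCoordinates.
Context {R : realType} {m n : nat}.
Local Notation V := (jet_model R m n).

Definition jet_idx := ('I_m + 'I_n + vidx m n)%type.

Definition jet_base (k : jet_idx) : V :=
  match k with
  | inl (inl a) => (delta_mx 0 a, 0, 0)
  | inl (inr i) => (0, delta_mx 0 i, 0)
  | inr q => (0, 0, delta_mx q.1 q.2)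
  end.

Definition jet_coord (k : jet_idx) (v : V) : R^o :=
  match k with
  | inl (inl a) => v.1.1 0 a
  | inl (inr i) => v.1.2 0 i
  | inr q => v.2 q.1 q.2
  end.

Lemma jet_coord_linear k : linear (jet_coord k).
Proof. by move=> a u v; case: k => [[b|i]|q] /=; rewrite !mxE. Qed.

HB.instance Definition _ k :=
  GRing.isLinear.Build R V R^o _ (jet_coord k) (jet_coord_linear k).

Lemma jet_coord_continuous k : continuous (jet_coord k).
Proof.
move=> v; case: k => [[a|i]|q].
- apply: (@continuous_comp _ _ _ (fun v : V => v.1.1) (fun M => M 0 a)).
    by apply: (@continuous_comp _ _ _ (fun v : V => v.1) fst); exact: cvg_fst.
  exact: coord_continuous.
- apply: (@continuous_comp _ _ _ (fun v : V => v.1.2) (fun M => M 0 i)).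
    apply: (@continuous_comp _ _ _ (fun v : V => v.1) snd); first exact: cvg_fst.
    exact: cvg_snd.
  exact: coord_continuous.
- apply: (@continuous_comp _ _ _ (fun v : V => v.2) (fun M => M q.1 q.2)).
    exact: cvg_snd.
  exact: coord_continuous.
Qed.

Lemma jet_coord_expand v : v = \sum_k jet_coord k v *: jet_base k.
Proof.
have s1 (I : finType) (F : I -> V) : (\sum_i F i).1 = \sum_i (F i).1.
  by apply: (big_morph fst).
have s2 (I : finType) (F : I -> V) : (\sum_i F i).2 = \sum_i (F i).2.
  by apply: (big_morph snd).
have s11 (I : finType) (F : I -> 'rV[R]_m * 'rV[R]_n) :
  (\sum_i F i).1 = \sum_i (F i).1 by apply: (big_morph fst).
have s12 (I : finType) (F : I -> 'rV[R]_m * 'rV[R]_n) :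
  (\sum_i F i).2 = \sum_i (F i).2 by apply: (big_morph snd).
rewrite !big_sumType /=; case: v => [[t x] p].
rewrite [RHS]surjective_pairing [X in (X, _)]surjective_pairing.
congr (_, _, _); rewrite /= ?s1 ?s2 /= ?s11 ?s12 /=.
- rewrite [X in _ + X + _]big1 ?[X in _ + X]big1 ?addr0 => [|i _|i _].
  + exact: row_sum_delta.
  + by rewrite scaler0.
  + by rewrite scaler0.
- rewrite [X in X + _ + _]big1 ?[X in _ + X]big1 ?addr0 ?add0r => [|i _|i _].
  + exact: row_sum_delta.
  + by rewrite scaler0.
  + by rewrite scaler0.
- rewrite [X in X + _ + _]big1 ?[X in _ + X + _]big1 ?add0r => [|i _|i _].
  + by rewrite [LHS]matrix_sum_delta pair_bigA.
  + by rewrite scaler0.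
  + by rewrite scaler0.
Qed.

Definition jet_coords : linear_coords V jet_idx :=
  LinearCoords jet_coord_continuous jet_coord_expand.

End JetCoordinates.

Section AdaptedFrame.
Context {R : realType} {m n : nat} {T : manifold 'rV[R]_m}
  {M : manifold 'rV[R]_n} {E : jet_dual T M}.
Variables (c : chart (jet_model R m n) E) (ac : atlas c)
  (nc : ncoeffs (m:=m) (n:=n) (R:=R) E).
Local Notation U := (cdom c).
Hypotheses (sN1 : forall q a, smooth_on U (N1 nc q a))
  (sN2 : forall q i, smooth_on U (N2 nc q i)).

Let oU : open U := chart_open ac.

Lemma partial_p_vfield q : is_vfield U (partial_p c q).
Proof. exact: (coord_field_vfield jet_coords). Qed.

Lemma delta_t_vfield a : is_vfield U (delta_t c nc a).
Proof. exact: (vfield_sub_vcomb ac jet_coords). Qed.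

Lemma delta_x_vfield i : is_vfield U (delta_x c nc i).
Proof. exact: (vfield_sub_vcomb ac jet_coords). Qed.

Lemma bracket_tt a b : vfield_eq U (bracket (delta_t c nc a) (delta_t c nc b))
  (vcomb (fun q e => - NR_tt c nc q b a e) (partial_p c)).
Proof. exact: (bracket_adapted ac jet_coords). Qed.

Lemma bracket_xt k b : vfield_eq U (bracket (delta_x c nc k) (delta_t c nc b))
  (vcomb (fun q e => - NR_tx c nc q b k e) (partial_p c)).
Proof. exact: (bracket_adapted ac jet_coords). Qed.

Lemma bracket_xx k j : vfield_eq U (bracket (delta_x c nc k) (delta_x c nc j))
  (vcomb (fun q e => - NR_xx c nc q j k e) (partial_p c)).
Proof. exact: (bracket_adapted ac jet_coords). Qed.

Lemma bracket_pt s b : vfield_eq U (bracket (partial_p c s) (delta_t c nc b))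
  (vcomb (fun q e => - partial_p c s e (N1 nc q b)) (partial_p c)).
Proof. exact: (bracket_coord_adapted ac jet_coords). Qed.

Lemma bracket_px s j : vfield_eq U (bracket (partial_p c s) (delta_x c nc j))
  (vcomb (fun q e => - partial_p c s e (N2 nc q j)) (partial_p c)).
Proof. exact: (bracket_coord_adapted ac jet_coords). Qed.

Lemma bracket_pp s q : vfield_eq U (bracket (partial_p c s) (partial_p c q))
  (vcomb (fun _ _ => - 0) (partial_p c)).
Proof.
move=> e Ue f sf; rewrite bracket_coord // /vcomb big1 // => r _.
by rewrite oppr0 mul0r.
Qed.

Let coord_fun k (x : E) : R := jet_coord k (cfwd c x).

Let coord_fun_smooth k : smooth_on U (coord_fun k).
Proof. exact: (smooth_on_coord jet_coords). Qed.

Let coord_funE v k e : U e -> coord_field c v e (coord_fun k) = jet_coord k v.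
Proof. exact: (coord_field_coord jet_coords). Qed.

Let delta_mx_dual (p q : nat) (i k : 'I_p) (j l : 'I_q) :
  delta_mx i j k l = ((i, j) == (k, l))%:R :> R.
Proof. by rewrite mxE xpair_eqE [k == i]eq_sym [l == j]eq_sym. Qed.

Lemma partial_p_free : frame_free U (partial_p c).
Proof.
apply: (dual_frame_free oU (fun q => coord_fun_smooth (inr q))) => e q s Ue.
by rewrite /partial_p coord_funE //= delta_mx_dual; case: q s => [? ?] [].
Qed.

Lemma delta_t_free : frame_free U (delta_t c nc).
Proof.
apply: (dual_frame_free oU (fun a => coord_fun_smooth (inl (inl a)))) => e a b Ue.
rewrite /delta_t /vsub /vcomb big1 => [|q _];
  rewrite ?/partial_p ?/partial_t coord_funE //=.
  by rewrite subr0 delta_mx_dual xpair_eqE eqxx.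
by rewrite mxE mulr0.
Qed.

Lemma delta_x_free : frame_free U (delta_x c nc).
Proof.
apply: (dual_frame_free oU (fun i => coord_fun_smooth (inl (inr i)))) => e i j Ue.
rewrite /delta_x /vsub /vcomb big1 => [|q _];
  rewrite ?/partial_p ?/partial_x coord_funE //=.
  by rewrite subr0 delta_mx_dual xpair_eqE eqxx.
by rewrite mxE mulr0.
Qed.

Lemma smooth_delta_t f a : smooth_on U f ->
  smooth_on U (fun e => delta_t c nc a e f).
Proof. by move=> sf; case: (delta_t_vfield a) => _; exact. Qed.

Lemma smooth_delta_x f i : smooth_on U f ->
  smooth_on U (fun e => delta_x c nc i e f).
Proof. by move=> sf; case: (delta_x_vfield i) => _; exact. Qed.

Lemma smooth_partial_p f q : smooth_on U f ->
  smooth_on U (fun e => partial_p c q e f).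
Proof. by move=> sf; case: (partial_p_vfield q) => _; exact. Qed.

End AdaptedFrame.

(** * Curvature on each of the three distributions *)

Lemma sum_pairE (R : nmodType) (m n : nat) (F : vidx m n -> R) :
  \sum_q F q = \sum_f \sum_r F (f, r).
Proof. by rewrite pair_bigA; apply: eq_bigr => -[]. Qed.

Section CurvatureComponents.
Context {R : realType} {m n : nat} {T : manifold 'rV[R]_m}
  {M : manifold 'rV[R]_n} {E : jet_dual T M}.
Variables (D : vfield R E -> vfield R E -> vfield R E) (hD : is_connection D).
Variables (c : chart (jet_model R m n) E) (ac : atlas c).
Variables (nc : ncoeffs (R:=R) (m:=m) (n:=n) E)
  (G : dcoeffs (R:=R) (m:=m) (n:=n) E).
Local Notation U := (cdom c).
Hypotheses (sN1 : forall q a, smooth_on U (N1 nc q a))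
  (sN2 : forall q i, smooth_on U (N2 nc q i)) (hG : is_dcoeffs D c nc G).

Local Notation dt := (delta_t c nc).
Local Notation dx := (delta_x c nc).
Local Notation dp := (partial_p c).

Let oU : open U := chart_open ac.
Let vdt a : is_vfield U (dt a) := delta_t_vfield ac sN1 a.
Let vdx i : is_vfield U (dx i) := delta_x_vfield ac sN2 i.
Let vdp q : is_vfield U (dp q) := partial_p_vfield ac q.

Let sNR_tt b g q : smooth_on U (NR_tt c nc q b g).
Proof. by apply: smooth_onB => //; apply: (smooth_delta_t ac sN1). Qed.

Let sNR_tx b k q : smooth_on U (NR_tx c nc q b k).
Proof.
apply: smooth_onB => //; first exact: (smooth_delta_x ac sN2).
exact: (smooth_delta_t ac sN1).
Qed.

Let sNR_xx j k q : smooth_on U (NR_xx c nc q j k).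
Proof. by apply: smooth_onB => //; apply: (smooth_delta_x ac sN2). Qed.

Let sN1p s b q : smooth_on U (fun e => dp s e (N1 nc q b)).
Proof. exact: (smooth_partial_p ac). Qed.

Let sN2p s j q : smooth_on U (fun e => dp s e (N2 nc q j)).
Proof. exact: (smooth_partial_p ac). Qed.

Let s0 (q : vidx m n) : smooth_on U (fun=> 0).
Proof. exact: smooth_on_cst. Qed.

Section HorizontalFrame.
Variables (I : finType) (Z : I -> vfield R E).
Hypotheses (vZ : forall i, is_vfield U (Z i)) (Zfree : frame_free U Z).
Variables (A : I -> I -> 'I_m -> E -> R) (H : I -> I -> 'I_n -> E -> R)
  (C : I -> I -> vidx m n -> E -> R).
Hypotheses (sA : forall a b g, smooth_on U (A a b g))
  (sH : forall a b k, smooth_on U (H a b k))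
  (sC : forall a b s, smooth_on U (C a b s)).
Hypothesis DA : forall g b,
  vfield_eq U (D (dt g) (Z b)) (vcomb (fun a => A a b g) Z).
Hypothesis DH : forall k b,
  vfield_eq U (D (dx k) (Z b)) (vcomb (fun a => H a b k) Z).
Hypothesis DC : forall s b,
  vfield_eq U (D (dp s) (Z b)) (vcomb (fun a => C a b s) Z).

(** Here Z is meant to be either of the families delta/delta t and delta/delta x,
    on which the coefficients of the connection enter with a plus sign. *)
Lemma curvature_hor_tt a b g (K : I -> E -> R) :
  vfield_eq U (curvature D (dt g) (dt b) (Z a)) (vcomb K Z) <->
  forall e, U e -> forall d, K d e =
    dt g e (A d a b) - dt b e (A d a g)
    + \sum_f A f a b e * A d f g e - \sum_f A f a g e * A d f b e
    + \sum_f \sum_r C d a (f, r) e * NR_tt c nc (f, r) b g e.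
Proof.
have KP := curvature_frameP hD oU vZ vdp Zfree
  (vdt g) (vdt b) (fun x y => sA x y g) (fun x y => sA x y b)
  (sNR_tt b g) (DA g) (DA b) DC (bracket_tt ac sN1 g b) a K.
apply: iff_trans KP _.
by split=> KE e Ue d; rewrite KE // sum_pairE.
Qed.

Lemma curvature_hor_tx a b k (K : I -> E -> R) :
  vfield_eq U (curvature D (dx k) (dt b) (Z a)) (vcomb K Z) <->
  forall e, U e -> forall d, K d e =
    dx k e (A d a b) - dt b e (H d a k)
    + \sum_f A f a b e * H d f k e - \sum_f H f a k e * A d f b e
    + \sum_f \sum_r C d a (f, r) e * NR_tx c nc (f, r) b k e.
Proof.
have KP := curvature_frameP hD oU vZ vdp Zfree
  (vdx k) (vdt b) (fun x y => sH x y k) (fun x y => sA x y b)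
  (sNR_tx b k) (DH k) (DA b) DC (bracket_xt ac sN1 sN2 k b) a K.
apply: iff_trans KP _.
by split=> KE e Ue d; rewrite KE // sum_pairE.
Qed.

Lemma curvature_hor_xx a j k (K : I -> E -> R) :
  vfield_eq U (curvature D (dx k) (dx j) (Z a)) (vcomb K Z) <->
  forall e, U e -> forall d, K d e =
    dx k e (H d a j) - dx j e (H d a k)
    + \sum_f H f a j e * H d f k e - \sum_f H f a k e * H d f j e
    + \sum_f \sum_r C d a (f, r) e * NR_xx c nc (f, r) j k e.
Proof.
have KP := curvature_frameP hD oU vZ vdp Zfree
  (vdx k) (vdx j) (fun x y => sH x y k) (fun x y => sH x y j)
  (sNR_xx j k) (DH k) (DH j) DC (bracket_xx ac sN2 k j) a K.
apply: iff_trans KP _.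
by split=> KE e Ue d; rewrite KE // sum_pairE.
Qed.

(** The subtracted bracket is the covariant derivative of C with respect to t,
    with its index terms in the order upper, lower, vertical.  Its last term cancels
    against the coefficient that the torsion adds to the derivative of N. *)
Lemma curvature_hor_tp a b s (K : I -> E -> R) :
  vfield_eq U (curvature D (dp s) (dt b) (Z a)) (vcomb K Z) <->
  forall e, U e -> forall d, K d e =
    dp s e (A d a b) -
    (dt b e (C d a s) + (\sum_f C f a s e * A d f b e +
      (\sum_f C d f s e * - A f a b e +
      (\sum_q C d a q e * A_V G q s b e + 0))))
    + \sum_f \sum_r C d a (f, r) e * NP_t c nc G (f, r) b s e.
Proof.
have KP := curvature_frameP hD oU vZ vdp Zfree
  (vdp s) (vdt b) (fun x y => sC x y s) (fun x y => sA x y b)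
  (sN1p s b) (DC s) (DA b) DC (bracket_pt ac sN1 s b) a K.
apply: iff_trans KP _.
have torsionE e d : \sum_f \sum_r C d a (f, r) e * NP_t c nc G (f, r) b s e =
    \sum_q C d a q e * dp s e (N1 nc q b) + \sum_q C d a q e * A_V G q s b e.
  rewrite -big_split [RHS]sum_pairE /=.
  by apply: eq_bigr => f _; apply: eq_bigr => r _; rewrite mulrDr.
have actE e d : \sum_f C d f s e * - A f a b e =
    - \sum_f A f a b e * C d f s e.
  by rewrite -sumrN; apply: eq_bigr => f _; rewrite mulrN mulrC.
by split=> KE e Ue d; rewrite KE // torsionE actE; ring.
Qed.

Lemma curvature_hor_xp a j s (K : I -> E -> R) :
  vfield_eq U (curvature D (dp s) (dx j) (Z a)) (vcomb K Z) <->
  forall e, U e -> forall d, K d e =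
    dp s e (H d a j) -
    (dx j e (C d a s) + (\sum_f C f a s e * H d f j e +
      (\sum_f C d f s e * - H f a j e +
      (\sum_q C d a q e * H_V G q s j e + 0))))
    + \sum_f \sum_r C d a (f, r) e * NP_x c nc G (f, r) j s e.
Proof.
have KP := curvature_frameP hD oU vZ vdp Zfree
  (vdp s) (vdx j) (fun x y => sC x y s) (fun x y => sH x y j)
  (sN2p s j) (DC s) (DH j) DC (bracket_px ac sN2 s j) a K.
apply: iff_trans KP _.
have torsionE e d : \sum_f \sum_r C d a (f, r) e * NP_x c nc G (f, r) j s e =
    \sum_q C d a q e * dp s e (N2 nc q j) + \sum_q C d a q e * H_V G q s j e.
  rewrite -big_split [RHS]sum_pairE /=.
  by apply: eq_bigr => f _; apply: eq_bigr => r _; rewrite mulrDr.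
have actE e d : \sum_f C d f s e * - H f a j e =
    - \sum_f H f a j e * C d f s e.
  by rewrite -sumrN; apply: eq_bigr => f _; rewrite mulrN mulrC.
by split=> KE e Ue d; rewrite KE // torsionE actE; ring.
Qed.

Lemma curvature_hor_pp a u s (K : I -> E -> R) :
  vfield_eq U (curvature D (dp s) (dp u) (Z a)) (vcomb K Z) <->
  forall e, U e -> forall d, K d e =
    dp s e (C d a u) - dp u e (C d a s)
    + \sum_f C f a u e * C d f s e - \sum_f C f a s e * C d f u e.
Proof.
have KP := curvature_frameP hD oU vZ vdp Zfree
  (vdp s) (vdp u) (fun x y => sC x y s) (fun x y => sC x y u)
  (s0) (DC s) (DC u) DC (bracket_pp ac s u) a K.
apply: iff_trans KP _.
have torsion0 e d : \sum_q C d a q e * 0 = 0.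
  by rewrite big1 // => q _; rewrite mulr0.
by split=> KE e Ue d; rewrite KE // torsion0 addr0.
Qed.

End HorizontalFrame.

Section VerticalFrame.
Local Notation A := (A_V G).
Local Notation H := (H_V G).
Local Notation C := (C_V G).
Let sG := dcoeffs_smooth hG.

Lemma curvature_ver_tt q b g (K : vidx m n -> E -> R) :
  vfield_eq U (curvature D (dt g) (dt b) (dp q))
    (vcomb (fun p e => - K p e) dp) <->
  forall e, U e -> forall p, K p e =
    dt g e (A p q b) - dt b e (A p q g)
    + \sum_f \sum_r A p (f, r) b e * A (f, r) q g e
    - \sum_f \sum_r A p (f, r) g e * A (f, r) q b e
    + \sum_f \sum_r C p q (f, r) e * NR_tt c nc (f, r) b g e.
Proof.
have KP := curvature_frameNP hD oU vdp vdp (partial_p_free ac)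
  (vdt g) (vdt b)
  (fun x y => smooth_A_V sG x y g) (fun x y => smooth_A_V sG x y b) (sNR_tt b g)
  (dcoeffs_A_V hG g) (dcoeffs_A_V hG b)
  (dcoeffs_C_V hG) (bracket_tt ac sN1 g b) q K.
apply: iff_trans KP _.
by split=> KE e Ue p; rewrite KE // !sum_pairE.
Qed.

Lemma curvature_ver_tx q b k (K : vidx m n -> E -> R) :
  vfield_eq U (curvature D (dx k) (dt b) (dp q))
    (vcomb (fun p e => - K p e) dp) <->
  forall e, U e -> forall p, K p e =
    dx k e (A p q b) - dt b e (H p q k)
    + \sum_f \sum_r A p (f, r) b e * H (f, r) q k e
    - \sum_f \sum_r H p (f, r) k e * A (f, r) q b e
    + \sum_f \sum_r C p q (f, r) e * NR_tx c nc (f, r) b k e.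
Proof.
have KP := curvature_frameNP hD oU vdp vdp (partial_p_free ac)
  (vdx k) (vdt b)
  (fun x y => smooth_H_V sG x y k) (fun x y => smooth_A_V sG x y b) (sNR_tx b k)
  (dcoeffs_H_V hG k) (dcoeffs_A_V hG b)
  (dcoeffs_C_V hG) (bracket_xt ac sN1 sN2 k b) q K.
apply: iff_trans KP _.
by split=> KE e Ue p; rewrite KE // !sum_pairE.
Qed.

Lemma curvature_ver_xx q j k (K : vidx m n -> E -> R) :
  vfield_eq U (curvature D (dx k) (dx j) (dp q))
    (vcomb (fun p e => - K p e) dp) <->
  forall e, U e -> forall p, K p e =
    dx k e (H p q j) - dx j e (H p q k)
    + \sum_f \sum_r H p (f, r) j e * H (f, r) q k e
    - \sum_f \sum_r H p (f, r) k e * H (f, r) q j e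
    + \sum_f \sum_r C p q (f, r) e * NR_xx c nc (f, r) j k e.
Proof.
have KP := curvature_frameNP hD oU vdp vdp (partial_p_free ac)
  (vdx k) (vdx j)
  (fun x y => smooth_H_V sG x y k) (fun x y => smooth_H_V sG x y j) (sNR_xx j k)
  (dcoeffs_H_V hG k) (dcoeffs_H_V hG j)
  (dcoeffs_C_V hG) (bracket_xx ac sN2 k j) q K.
apply: iff_trans KP _.
by split=> KE e Ue p; rewrite KE // !sum_pairE.
Qed.

(** As in [curvature_hor_tp], but now the first two indices of C are vertical
    pairs, so that the first two correction terms have the opposite signs. *)
Lemma curvature_ver_tp q b s (K : vidx m n -> E -> R) :
  vfield_eq U (curvature D (dp s) (dt b) (dp q))
    (vcomb (fun p e => - K p e) dp) <->
  forall e, U e -> forall p, K p e =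
    dp s e (A p q b) -
    (dt b e (C p q s) + (\sum_r C r q s e * - A p r b e +
      (\sum_r C p r s e * A r q b e +
      (\sum_r C p q r e * A r s b e + 0))))
    + \sum_f \sum_r C p q (f, r) e * NP_t c nc G (f, r) b s e.
Proof.
have KP := curvature_frameNP hD oU vdp vdp (partial_p_free ac)
  (vdp s) (vdt b)
  (fun x y => smooth_C_V sG x y s) (fun x y => smooth_A_V sG x y b) (sN1p s b)
  (dcoeffs_C_V hG s) (dcoeffs_A_V hG b)
  (dcoeffs_C_V hG) (bracket_pt ac sN1 s b) q K.
apply: iff_trans KP _.
have torsionE e p : \sum_f \sum_r C p q (f, r) e * NP_t c nc G (f, r) b s e =
    \sum_r C p q r e * dp s e (N1 nc r b) + \sum_r C p q r e * A r s b e.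
  rewrite -big_split [RHS]sum_pairE /=.
  by apply: eq_bigr => f _; apply: eq_bigr => r _; rewrite mulrDr.
have actE e p : \sum_r C r q s e * - A p r b e =
    - \sum_r A p r b e * C r q s e.
  by rewrite -sumrN; apply: eq_bigr => r _; rewrite mulrN mulrC.
by split=> KE e Ue p; rewrite KE // torsionE actE; ring.
Qed.

Lemma curvature_ver_xp q j s (K : vidx m n -> E -> R) :
  vfield_eq U (curvature D (dp s) (dx j) (dp q))
    (vcomb (fun p e => - K p e) dp) <->
  forall e, U e -> forall p, K p e =
    dp s e (H p q j) -
    (dx j e (C p q s) + (\sum_r C r q s e * - H p r j e +
      (\sum_r C p r s e * H r q j e +
      (\sum_r C p q r e * H r s j e + 0))))
    + \sum_f \sum_r C p q (f, r) e * NP_x c nc G (f, r) j s e.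
Proof.
have KP := curvature_frameNP hD oU vdp vdp (partial_p_free ac)
  (vdp s) (vdx j)
  (fun x y => smooth_C_V sG x y s) (fun x y => smooth_H_V sG x y j) (sN2p s j)
  (dcoeffs_C_V hG s) (dcoeffs_H_V hG j)
  (dcoeffs_C_V hG) (bracket_px ac sN2 s j) q K.
apply: iff_trans KP _.
have torsionE e p : \sum_f \sum_r C p q (f, r) e * NP_x c nc G (f, r) j s e =
    \sum_r C p q r e * dp s e (N2 nc r j) + \sum_r C p q r e * H r s j e.
  rewrite -big_split [RHS]sum_pairE /=.
  by apply: eq_bigr => f _; apply: eq_bigr => r _; rewrite mulrDr.
have actE e p : \sum_r C r q s e * - H p r j e =
    - \sum_r H p r j e * C r q s e.
  by rewrite -sumrN; apply: eq_bigr => r _; rewrite mulrN mulrC.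
by split=> KE e Ue p; rewrite KE // torsionE actE; ring.
Qed.

Lemma curvature_ver_pp q u s (K : vidx m n -> E -> R) :
  vfield_eq U (curvature D (dp s) (dp u) (dp q))
    (vcomb (fun p e => - K p e) dp) <->
  forall e, U e -> forall p, K p e =
    dp s e (C p q u) - dp u e (C p q s)
    + \sum_f \sum_r C p (f, r) u e * C (f, r) q s e
    - \sum_f \sum_r C p (f, r) s e * C (f, r) q u e.
Proof.
have KP := curvature_frameNP hD oU vdp vdp (partial_p_free ac)
  (vdp s) (vdp u)
  (fun x y => smooth_C_V sG x y s) (fun x y => smooth_C_V sG x y u) (s0)
  (dcoeffs_C_V hG s) (dcoeffs_C_V hG u)
  (dcoeffs_C_V hG) (bracket_pp ac s u) q K.
apply: iff_trans KP _.
have torsion0 e p : \sum_r C p q r e * 0 = 0.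
  by rewrite big1 // => r _; rewrite mulr0.
by split=> KE e Ue p; rewrite KE // torsion0 addr0 !sum_pairE.
Qed.

End VerticalFrame.
End CurvatureComponents.

(** * The eighteen curvature d-tensors *)

Theorem theorem8p3 (R : realType) (m n : nat)
    (T : manifold 'rV[R]_m) (M : manifold 'rV[R]_n) (E : jet_dual T M)
    (N : E -> set (functional R E)) (hN : is_nonlinear_connection N)
    (D : vfield R E -> vfield R E -> vfield R E) (hD : is_Nlinear N D)
    (cT : chart 'rV[R]_m T) (cM : chart 'rV[R]_n M)
    (hcT : atlas cT) (hcM : atlas cM)
    (nc : ncoeffs E) (hnc : is_ncoeffs N (jet_chart E cT cM) nc)
    (G : dcoeffs E) (hG : is_dcoeffs D (jet_chart E cT cM) nc G)
    (K : curv_comps E) :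
  let ch := jet_chart E cT cM in
  let dt := fun (c : 'I_m) (F : E -> R) (e : E) => delta_t ch nc c e F in
  let dx := fun (k : 'I_n) (F : E -> R) (e : E) => delta_x ch nc k e F in
  let dp := fun (c : 'I_m) (k : 'I_n) (F : E -> R) (e : E) =>
    partial_p ch (c, k) e F in
  is_curv_comps D ch nc K <->
  (forall e : E, cdom ch e ->
  (* 1 *) (forall (d a b c : 'I_m), RT_tt K d a b c e =
    dt c (A_T G d a b) e - dt b (A_T G d a c) e
    + \sum_f A_T G f a b e * A_T G d f c e
    - \sum_f A_T G f a c e * A_T G d f b e
    + \sum_f \sum_r C_T G d a (f, r) e * NR_tt ch nc (f, r) b c e) /\
  (* 2 *) (forall (d a b : 'I_m) (k : 'I_n), RT_tx K d a b k e =
    dx k (A_T G d a b) e - dt b (H_T G d a k) e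
    + \sum_f A_T G f a b e * H_T G d f k e
    - \sum_f H_T G f a k e * A_T G d f b e
    + \sum_f \sum_r C_T G d a (f, r) e * NR_tx ch nc (f, r) b k e) /\
  (* 3 *) (forall (d a b c : 'I_m) (k : 'I_n), PT_tp K d a b (c, k) e =
    dp c k (A_T G d a b) e - CT_cov_t ch nc G d a (c, k) b e
    + \sum_f \sum_r C_T G d a (f, r) e * NP_t ch nc G (f, r) b (c, k) e) /\
  (* 4 *) (forall (d a : 'I_m) (j k : 'I_n), RT_xx K d a j k e =
    dx k (H_T G d a j) e - dx j (H_T G d a k) e
    + \sum_f H_T G f a j e * H_T G d f k e
    - \sum_f H_T G f a k e * H_T G d f j e
    + \sum_f \sum_r C_T G d a (f, r) e * NR_xx ch nc (f, r) j k e) /\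
  (* 5 *) (forall (d a c : 'I_m) (j k : 'I_n), PT_xp K d a j (c, k) e =
    dp c k (H_T G d a j) e - CT_cov_x ch nc G d a (c, k) j e
    + \sum_f \sum_r C_T G d a (f, r) e * NP_x ch nc G (f, r) j (c, k) e) /\
  (* 6 *) (forall (d a b c : 'I_m) (j k : 'I_n), ST_pp K d a (b, j) (c, k) e =
    dp c k (C_T G d a (b, j)) e - dp b j (C_T G d a (c, k)) e
    + \sum_f C_T G f a (b, j) e * C_T G d f (c, k) e
    - \sum_f C_T G f a (c, k) e * C_T G d f (b, j) e) /\
  (* 7 *) (forall (l i : 'I_n) (b c : 'I_m), RM_tt K l i b c e =
    dt c (A_M G l i b) e - dt b (A_M G l i c) e
    + \sum_r A_M G r i b e * A_M G l r c e
    - \sum_r A_M G r i c e * A_M G l r b e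
    + \sum_f \sum_r C_M G l i (f, r) e * NR_tt ch nc (f, r) b c e) /\
  (* 8 *) (forall (l i : 'I_n) (b : 'I_m) (k : 'I_n), RM_tx K l i b k e =
    dx k (A_M G l i b) e - dt b (H_M G l i k) e
    + \sum_r A_M G r i b e * H_M G l r k e
    - \sum_r H_M G r i k e * A_M G l r b e
    + \sum_f \sum_r C_M G l i (f, r) e * NR_tx ch nc (f, r) b k e) /\
  (* 9 *) (forall (l i : 'I_n) (b c : 'I_m) (k : 'I_n),
    PM_tp K l i b (c, k) e =
    dp c k (A_M G l i b) e - CM_cov_t ch nc G l i (c, k) b e
    + \sum_f \sum_r C_M G l i (f, r) e * NP_t ch nc G (f, r) b (c, k) e) /\
  (* 10 *) (forall (l i j k : 'I_n), RM_xx K l i j k e =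
    dx k (H_M G l i j) e - dx j (H_M G l i k) e
    + \sum_r H_M G r i j e * H_M G l r k e
    - \sum_r H_M G r i k e * H_M G l r j e
    + \sum_f \sum_r C_M G l i (f, r) e * NR_xx ch nc (f, r) j k e) /\
  (* 11 *) (forall (l i j : 'I_n) (c : 'I_m) (k : 'I_n),
    PM_xp K l i j (c, k) e =
    dp c k (H_M G l i j) e - CM_cov_x ch nc G l i (c, k) j e
    + \sum_f \sum_r C_M G l i (f, r) e * NP_x ch nc G (f, r) j (c, k) e) /\
  (* 12 *) (forall (l i : 'I_n) (b c : 'I_m) (j k : 'I_n),
    SM_pp K l i (b, j) (c, k) e =
    dp c k (C_M G l i (b, j)) e - dp b j (C_M G l i (c, k)) e
    + \sum_r C_M G r i (b, j) e * C_M G l r (c, k) e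
    - \sum_r C_M G r i (c, k) e * C_M G l r (b, j) e) /\
  (* 13 *) (forall (d a b c : 'I_m) (l i : 'I_n),
    RV_tt K (d, l) (a, i) b c e =
    dt c (A_V G (d, l) (a, i) b) e - dt b (A_V G (d, l) (a, i) c) e
    + \sum_f \sum_r A_V G (d, l) (f, r) b e * A_V G (f, r) (a, i) c e
    - \sum_f \sum_r A_V G (d, l) (f, r) c e * A_V G (f, r) (a, i) b e
    + \sum_f \sum_r
        C_V G (d, l) (a, i) (f, r) e * NR_tt ch nc (f, r) b c e) /\
  (* 14 *) (forall (d a b : 'I_m) (l i k : 'I_n),
    RV_tx K (d, l) (a, i) b k e =
    dx k (A_V G (d, l) (a, i) b) e - dt b (H_V G (d, l) (a, i) k) e
    + \sum_f \sum_r A_V G (d, l) (f, r) b e * H_V G (f, r) (a, i) k e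
    - \sum_f \sum_r H_V G (d, l) (f, r) k e * A_V G (f, r) (a, i) b e
    + \sum_f \sum_r
        C_V G (d, l) (a, i) (f, r) e * NR_tx ch nc (f, r) b k e) /\
  (* 15 *) (forall (d a b c : 'I_m) (l i k : 'I_n),
    PV_tp K (d, l) (a, i) b (c, k) e =
    dp c k (A_V G (d, l) (a, i) b) e - CV_cov_t ch nc G (d, l) (a, i) (c, k) b e
    + \sum_f \sum_r
        C_V G (d, l) (a, i) (f, r) e * NP_t ch nc G (f, r) b (c, k) e) /\
  (* 16 *) (forall (d a : 'I_m) (l i j k : 'I_n),
    RV_xx K (d, l) (a, i) j k e =
    dx k (H_V G (d, l) (a, i) j) e - dx j (H_V G (d, l) (a, i) k) e
    + \sum_f \sum_r H_V G (d, l) (f, r) j e * H_V G (f, r) (a, i) k e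
    - \sum_f \sum_r H_V G (d, l) (f, r) k e * H_V G (f, r) (a, i) j e
    + \sum_f \sum_r
        C_V G (d, l) (a, i) (f, r) e * NR_xx ch nc (f, r) j k e) /\
  (* 17 *) (forall (d a c : 'I_m) (l i j k : 'I_n),
    PV_xp K (d, l) (a, i) j (c, k) e =
    dp c k (H_V G (d, l) (a, i) j) e - CV_cov_x ch nc G (d, l) (a, i) (c, k) j e
    + \sum_f \sum_r
        C_V G (d, l) (a, i) (f, r) e * NP_x ch nc G (f, r) j (c, k) e) /\
  (* 18 *) (forall (d a b c : 'I_m) (l i j k : 'I_n),
    SV_pp K (d, l) (a, i) (b, j) (c, k) e =
    dp c k (C_V G (d, l) (a, i) (b, j)) e
    - dp b j (C_V G (d, l) (a, i) (c, k)) e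
    + \sum_f \sum_r
        C_V G (d, l) (f, r) (b, j) e * C_V G (f, r) (a, i) (c, k) e
    - \sum_f \sum_r
        C_V G (d, l) (f, r) (c, k) e * C_V G (f, r) (a, i) (b, j) e)).
Proof.
move=> ch dt dx dp.
have [hC _ _ _] := hD; have [sN1 sN2 _] := hnc.
have ac : atlas ch := jet_atlas E hcT hcM.
have sG := dcoeffs_smooth hG.
have vt := delta_t_vfield ac sN1; have ft := delta_t_free ac (nc := nc).
have vx := delta_x_vfield ac sN2; have fx := delta_x_free ac (nc := nc).
have ETtt a b g := curvature_hor_tt hC ac sN1 vt ft
  (smooth_A_T sG)
  (dcoeffs_A_T hG) (dcoeffs_C_T hG) a b g
  (fun d => RT_tt K d a b g).
have ETtx a b k := curvature_hor_tx hC ac sN1 sN2 vt ft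
  (smooth_A_T sG) (smooth_H_T sG)
  (dcoeffs_A_T hG) (dcoeffs_H_T hG) (dcoeffs_C_T hG) a b k
  (fun d => RT_tx K d a b k).
have ETtp a b s := curvature_hor_tp hC ac G sN1 vt ft
  (smooth_A_T sG) (smooth_C_T sG)
  (dcoeffs_A_T hG) (dcoeffs_C_T hG) a b s
  (fun d => PT_tp K d a b s).
have ETxx a j k := curvature_hor_xx hC ac sN2 vt ft
  (smooth_H_T sG)
  (dcoeffs_H_T hG) (dcoeffs_C_T hG) a j k
  (fun d => RT_xx K d a j k).
have ETxp a j s := curvature_hor_xp hC ac G sN2 vt ft
  (smooth_H_T sG) (smooth_C_T sG)
  (dcoeffs_H_T hG) (dcoeffs_C_T hG) a j s
  (fun d => PT_xp K d a j s).
have ETpp a u s := curvature_hor_pp hC ac vt ft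
  (smooth_C_T sG)
  (dcoeffs_C_T hG) a u s
  (fun d => ST_pp K d a u s).
have EMtt a b g := curvature_hor_tt hC ac sN1 vx fx
  (smooth_A_M sG)
  (dcoeffs_A_M hG) (dcoeffs_C_M hG) a b g
  (fun d => RM_tt K d a b g).
have EMtx a b k := curvature_hor_tx hC ac sN1 sN2 vx fx
  (smooth_A_M sG) (smooth_H_M sG)
  (dcoeffs_A_M hG) (dcoeffs_H_M hG) (dcoeffs_C_M hG) a b k
  (fun d => RM_tx K d a b k).
have EMtp a b s := curvature_hor_tp hC ac G sN1 vx fx
  (smooth_A_M sG) (smooth_C_M sG)
  (dcoeffs_A_M hG) (dcoeffs_C_M hG) a b s
  (fun d => PM_tp K d a b s).
have EMxx a j k := curvature_hor_xx hC ac sN2 vx fx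
  (smooth_H_M sG)
  (dcoeffs_H_M hG) (dcoeffs_C_M hG) a j k
  (fun d => RM_xx K d a j k).
have EMxp a j s := curvature_hor_xp hC ac G sN2 vx fx
  (smooth_H_M sG) (smooth_C_M sG)
  (dcoeffs_H_M hG) (dcoeffs_C_M hG) a j s
  (fun d => PM_xp K d a j s).
have EMpp a u s := curvature_hor_pp hC ac vx fx
  (smooth_C_M sG)
  (dcoeffs_C_M hG) a u s
  (fun d => SM_pp K d a u s).
have EVtt q b g := curvature_ver_tt hC ac sN1 hG q b g
  (fun p => RV_tt K p q b g).
have EVtx q b k := curvature_ver_tx hC ac sN1 sN2 hG q b k
  (fun p => RV_tx K p q b k).
have EVtp q b s := curvature_ver_tp hC ac sN1 hG q b s
  (fun p => PV_tp K p q b s).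
have EVxx q j k := curvature_ver_xx hC ac sN2 hG q j k
  (fun p => RV_xx K p q j k).
have EVxp q j s := curvature_ver_xp hC ac sN2 hG q j s
  (fun p => PV_xp K p q j s).
have EVpp q u s := curvature_ver_pp hC ac hG q u s
  (fun p => SV_pp K p q u s).
split=> [[h1 h2 h3 h4 h5 h6 h7 h8 h9 h10 h11 h12 h13 h14 h15 h16 h17 h18] e Ue
  |hK].
  do ![split]=> *.
  - exact: (proj1 (ETtt _ _ _) (h1 _ _ _) e Ue).
  - exact: (proj1 (ETtx _ _ _) (h2 _ _ _) e Ue).
  - exact: (proj1 (ETtp _ _ _) (h3 _ _ _) e Ue).
  - exact: (proj1 (ETxx _ _ _) (h4 _ _ _) e Ue).
  - exact: (proj1 (ETxp _ _ _) (h5 _ _ _) e Ue).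
  - exact: (proj1 (ETpp _ _ _) (h6 _ _ _) e Ue).
  - exact: (proj1 (EMtt _ _ _) (h7 _ _ _) e Ue).
  - exact: (proj1 (EMtx _ _ _) (h8 _ _ _) e Ue).
  - exact: (proj1 (EMtp _ _ _) (h9 _ _ _) e Ue).
  - exact: (proj1 (EMxx _ _ _) (h10 _ _ _) e Ue).
  - exact: (proj1 (EMxp _ _ _) (h11 _ _ _) e Ue).
  - exact: (proj1 (EMpp _ _ _) (h12 _ _ _) e Ue).
  - exact: (proj1 (EVtt _ _ _) (h13 _ _ _) e Ue).
  - exact: (proj1 (EVtx _ _ _) (h14 _ _ _) e Ue).
  - exact: (proj1 (EVtp _ _ _) (h15 _ _ _) e Ue).
  - exact: (proj1 (EVxx _ _ _) (h16 _ _ _) e Ue).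
  - exact: (proj1 (EVxp _ _ _) (h17 _ _ _) e Ue).
  - exact: (proj1 (EVpp _ _ _) (h18 _ _ _) e Ue).
split.
- move=> a b g; apply: (proj2 (ETtt _ _ _)) => e Ue d.
  have := hK e Ue.
  by case=> + _; exact.
- move=> a b k; apply: (proj2 (ETtx _ _ _)) => e Ue d.
  have := hK e Ue.
  do 1!case=> _; case=> + _; exact.
- move=> a b [? ?]; apply: (proj2 (ETtp _ _ _)) => e Ue d.
  have := hK e Ue.
  do 2!case=> _; case=> + _; exact.
- move=> a j k; apply: (proj2 (ETxx _ _ _)) => e Ue d.
  have := hK e Ue.
  do 3!case=> _; case=> + _; exact.
- move=> a j [? ?]; apply: (proj2 (ETxp _ _ _)) => e Ue d.
  have := hK e Ue.
  do 4!case=> _; case=> + _; exact.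
- move=> a [? ?] [? ?]; apply: (proj2 (ETpp _ _ _)) => e Ue d.
  have := hK e Ue.
  do 5!case=> _; case=> + _; exact.
- move=> a b g; apply: (proj2 (EMtt _ _ _)) => e Ue d.
  have := hK e Ue.
  do 6!case=> _; case=> + _; exact.
- move=> a b k; apply: (proj2 (EMtx _ _ _)) => e Ue d.
  have := hK e Ue.
  do 7!case=> _; case=> + _; exact.
- move=> a b [? ?]; apply: (proj2 (EMtp _ _ _)) => e Ue d.
  have := hK e Ue.
  do 8!case=> _; case=> + _; exact.
- move=> a j k; apply: (proj2 (EMxx _ _ _)) => e Ue d.
  have := hK e Ue.
  do 9!case=> _; case=> + _; exact.
- move=> a j [? ?]; apply: (proj2 (EMxp _ _ _)) => e Ue d.
  have := hK e Ue.
  do 10!case=> _; case=> + _; exact.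
- move=> a [? ?] [? ?]; apply: (proj2 (EMpp _ _ _)) => e Ue d.
  have := hK e Ue.
  do 11!case=> _; case=> + _; exact.
- move=> [? ?] b g; apply: (proj2 (EVtt _ _ _)) => e Ue [? ?].
  have := hK e Ue.
  do 12!case=> _; case=> + _; exact.
- move=> [? ?] b k; apply: (proj2 (EVtx _ _ _)) => e Ue [? ?].
  have := hK e Ue.
  do 13!case=> _; case=> + _; exact.
- move=> [? ?] b [? ?]; apply: (proj2 (EVtp _ _ _)) => e Ue [? ?].
  have := hK e Ue.
  do 14!case=> _; case=> + _; exact.
- move=> [? ?] j k; apply: (proj2 (EVxx _ _ _)) => e Ue [? ?].
  have := hK e Ue.
  do 15!case=> _; case=> + _; exact.
- move=> [? ?] j [? ?]; apply: (proj2 (EVxp _ _ _)) => e Ue [? ?].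
  have := hK e Ue.
  do 16!case=> _; case=> + _; exact.
- move=> [? ?] [? ?] [? ?]; apply: (proj2 (EVpp _ _ _)) => e Ue [? ?].
  have := hK e Ue.
  do 17!case=> _; exact.
Qed.
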